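(* Let $n\ge 0$ and let $T$ be a tree on $2n+1$ vertices. Then \[n!\,2^n\le \nu(T)=\eta(T)\le (2n)!.\] Moreover, $\nu(T)=n!\,2^n$ if and only if $T$ is (isomorphic to) the hairbrush $H_n$, and $\nu(T)=(2n)!$ if and only if $T$ is the star $K_{1,2n}$.
   Context: For an $m$-vertex digraph $D$, a descent of a bijection $\sigma:V(D)\to[m]$ is an arc $u\to v$ with $\sigma(u)>\sigma(v)$; $A_D(t)=\sum_\sigma t^{\mathrm{des}_D(\sigma)}$ where $\mathrm{des}_D(\sigma)$ is the number of descents. For a graph $G$, $\nu(G):=|A_D(-1)|$ for any orientation $D$ of $G$ (independent of the orientation). An ordering $(\pi_1,\dots,\pi_m)$ of $V(G)$ is an even sequence if $G[\{\pi_1,\dots,\pi_i\}]$ has an even number of edges for all $i$; $\eta(G)$ is the number of even sequences. The hairbrush $H_n$ consists of a path $v_0v_1\cdots v_n$ together with, for each $1\le i\le n$, a new leaf $u_i$ adjacent to $v_i$ (so $H_0$ is a single vertex). The star $K_{1,2n}$ is a vertex adjacent to $2n$ leaves. *)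

(* Defs.v *)
From mathcomp Require Import all_boot all_order all_algebra.

Set Implicit Arguments.
Unset Strict Implicit.
Unset Printing Implicit Defensive.

Import GRing.Theory.

Record sgraph := SGraph {
  vertex :> finType;
  edge : rel vertex;
  edge_sym : symmetric edge;
  edge_irr : irreflexive edge }.

Definition edges (G : sgraph) : {set {set G}} :=
  [set [set p.1; p.2] | p : G * G & edge p.1 p.2].

Definition induced_edges (G : sgraph) (S : {set G}) : {set {set G}} :=
  [set A in edges G | A \subset S].

Definition connected_graph (G : sgraph) : Prop :=
  0 < #|G| /\ forall x y : G, connect (@edge G) x y.

(* [ucycle] accepts [:: x; y] for an edge xy, hence the bound on the length. *)
Definition acyclic (G : sgraph) : Prop :=
  forall c : seq G, 2 < size c -> ~ ucycle (@edge G) c.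

Definition is_tree (G : sgraph) : Prop := connected_graph G /\ acyclic G.

Definition isomorphic (G H : sgraph) : Prop :=
  exists2 f : G -> H, bijective f & forall x y, edge (f x) (f y) = edge x y.

Section Descents.
Variable V : finType.

Definition des (D : rel V) (s : {ffun V -> 'I_#|V|}) : nat :=
  #|[set p : V * V | D p.1 p.2 && (s p.2 < s p.1)]|.

(* The injective maps V -> 'I_#|V| are the bijections. The values are
   0, ..., m - 1 instead of 1, ..., m. *)
Definition Apoly (D : rel V) : {poly int} :=
  (\sum_(s : {ffun V -> 'I_#|V|} | injectiveb s) 'X^(des D s))%R.

End Descents.

Definition orientation (G : sgraph) (D : rel G) : Prop :=
  (forall u v, D u v || D v u = edge u v) /\
  (forall u v, ~~ (D u v && D v u)).

Definition std_orientation (G : sgraph) : rel G :=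
  fun u v => edge u v && (enum_rank u < enum_rank v).

(* The choice of orientation is immaterial: see [nuE]. *)
Definition nu (G : sgraph) : nat := absz (Apoly (@std_orientation G)).[-1]%R.

Definition even_sequence (G : sgraph) (s : #|G|.-tuple G) : bool :=
  uniq s &&
  [forall i : 'I_#|G|.+1, ~~ odd #|induced_edges [set x in take i s]| ].

Definition eta (G : sgraph) : nat :=
  #|[set s : #|G|.-tuple G | even_sequence s]|.

(* [inl i] is v_i for 0 <= i <= n; [inr j] is u_(j+1) for 0 <= j < n. *)
Definition hairbrush_rel (n : nat) : rel ('I_n.+1 + 'I_n) :=
  fun x y => match x, y with
  | inl i, inl j => (val j == i.+1) || (val i == j.+1)
  | inl i, inr j => val i == j.+1
  | inr j, inl i => val i == j.+1
  | inr _, inr _ => false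
  end.

Lemma hairbrush_sym n : symmetric (@hairbrush_rel n).
Proof. by move=> [i|i] [j|j] //=; rewrite orbC. Qed.

Lemma hairbrush_irr n : irreflexive (@hairbrush_rel n).
Proof. by move=> [i|i] //=; rewrite orbb; apply/negbTE; rewrite neq_ltn ltnSn. Qed.

Definition hairbrush (n : nat) : sgraph :=
  SGraph (@hairbrush_sym n) (@hairbrush_irr n).

(* [None] is the centre. *)
Definition star_rel (k : nat) : rel (option 'I_k) :=
  fun x y => isSome x != isSome y.

Lemma star_sym k : symmetric (@star_rel k).
Proof. by move=> x y; rewrite /star_rel eq_sym. Qed.

Lemma star_irr k : irreflexive (@star_rel k).
Proof. by move=> x; rewrite /star_rel eqxx. Qed.

Definition star (k : nat) : sgraph := SGraph (@star_sym k) (@star_irr k).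

Lemma std_orientationP (G : sgraph) : orientation (@std_orientation G).
Proof.
split=> u v; rewrite /std_orientation (edge_sym v u).
  case euv: (edge u v) => //=; rewrite -neq_ltn.
  apply/eqP => /val_inj /enum_rank_inj uv.
  by rewrite uv edge_irr in euv.
by case: (edge u v) => //=; case: ltngtP.
Qed.

Lemma des_orientation (G : sgraph) (D D' : rel G) (s : {ffun G -> 'I_#|G|}) :
  orientation D -> orientation D' -> injective s ->
  odd (des D s) = odd (des D' s) (+)
                  odd #|[set p : G * G | D p.1 p.2 && ~~ D' p.1 p.2]|.
Proof.
move=> [oD aD] [oD' aD'] sI.
set K := [set p | _ && _].
pose ds := [set p : G * G | s p.2 < s p.1].
pose K' := [set p : G * G | D' p.1 p.2 && ~~ D p.1 p.2].
pose B := [set p : G * G | [&& D p.1 p.2, D' p.1 p.2 & s p.2 < s p.1]].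
have desE : des D s = #|B| + #|K :&: ds|.
  rewrite /des -(cardsID [set p | D' p.1 p.2]); congr (_ + _); apply: eq_card => p.
    by rewrite !inE; do !case: (_ p.1 p.2) => //=; rewrite ?andbT ?andbF.
  by rewrite !inE; do !case: (_ p.1 p.2) => //=; rewrite ?andbT ?andbF.
have desE' : des D' s = #|B| + #|K' :&: ds|.
  rewrite /des -(cardsID [set p | D p.1 p.2]); congr (_ + _); apply: eq_card => p.
    by rewrite !inE; do !case: (_ p.1 p.2) => //=; rewrite ?andbT ?andbF.
  by rewrite !inE; do !case: (_ p.1 p.2) => //=; rewrite ?andbT ?andbF.
pose sw := fun p : G * G => (p.2, p.1).
have swK : involutive sw by case.
have K'E : #|K' :&: ds| = #|K :\: ds|.
  rewrite -(card_imset _ (inv_inj swK)); apply: eq_card => p.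
  rewrite -[p in LHS]swK mem_imset; last exact: inv_inj.
  case: p => u v; rewrite !inE /=.
  have := aD u v; have := aD' u v; have := oD u v; rewrite -oD'.
  case Duv: (D u v); case Dvu: (D v u); case: (D' u v); case: (D' v u) => //= _ _ _;
    rewrite ?andbF ?andbT //.
  case: (ltngtP (s u) (s v)) => // /val_inj /sI uv.
  by have := oD u v; rewrite Duv uv edge_irr.
rewrite desE desE' K'E -(cardsID ds K) !oddD.
by case: (odd #|B|); case: (odd #|K :&: ds|); case: (odd #|K :\: ds|).
Qed.

Lemma nuE (G : sgraph) (D : rel G) :
  orientation D -> absz (Apoly D).[-1]%R = nu G.
Proof.
move=> oD; rewrite /nu /Apoly !horner_sum.
pose k := #|[set p : G * G | D p.1 p.2 && ~~ std_orientation p.1 p.2]|.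
rewrite (eq_bigr (fun s => (-1) ^+ k * ('X^(des (@std_orientation G) s)).[-1])%R).
  by rewrite -mulr_sumr abszMsign.
move=> s /injectiveP sI; rewrite !hornerXn -exprD -[LHS]signr_odd -[RHS]signr_odd.
by rewrite (des_orientation oD (@std_orientationP G) sI) -/k addbC -oddD.
Qed.

(* Main.v *)
(* A tree on 2n + 1 vertices has a unique orientation D with all in-degrees
   even: modulo 2, the boundary map from edge sets to vertex sets is injective
   by acyclicity and hits every even set by connectedness. Hence the even
   sequences are exactly the linear extensions of D.

   For nu = eta, orient every edge from one colour class to the other. Reversing
   the orderings shows that the alternating sum vanishes on induced subgraphs
   with an odd number of edges, so it obeys the recursion that defines eta.

   Lower bound: the number of linear extensions is at least (2n+1)! divided by
   the product of the hooks h v = #|{u <= v}|, because the down-sets of the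
   sinks cover everything. Removing sinks one at a time, each h v is at most
   1 + the number of remaining arcs, so that product is at most
   1 * 3 * ... * (2n+1); equality forces the non-sources to form a chain with
   in-degrees 2, which is the hairbrush.

   Upper bound: no proper rotation of a linear extension is a linear extension,
   since some edge crosses the cut. Two disjoint arcs a -> b and c -> d produce
   a cyclic ordering without linear extension; without such arcs T is a star. *)

Require Import Defs.
From mathcomp Require Import all_boot all_order all_algebra zify.

Set Implicit Arguments.
Unset Strict Implicit.
Unset Printing Implicit Defensive.

(** * Parities of cardinalities and two-element sets *)

Lemma odd_card_addb (T : finType) (P Q : pred T) :
  odd #|[set x | P x (+) Q x]| = odd #|[set x | P x]| (+) odd #|[set x | Q x]|.
Proof.
rewrite -(cardsID [set x | Q x] [set x | P x]) -(cardsID [set x | P x] [set x | Q x]).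
rewrite -(cardsID [set x | P x] [set x | P x (+) Q x]) !oddD setIC.
have -> : [set x | P x (+) Q x] :\: [set x | P x] = [set x | Q x] :\: [set x | P x].
  by apply/setP => x; rewrite !inE; case: (P x).
have -> : [set x | P x] :&: [set x | P x (+) Q x] = [set x | P x] :\: [set x | Q x].
  by apply/setP => x; rewrite !inE; case: (P x); case: (Q x).
rewrite (setIC [set x | Q x]); set a := odd _; set b := odd _; set c := odd _.
by case: a; case: b; case: c.
Qed.

Lemma set2_eq (T : finType) (a b c d : T) :
  [set a; b] = [set c; d] -> a = c /\ b = d \/ a = d /\ b = c.
Proof.
move=> /setP E; have := E a; have := E b; have := E c; have := E d.
rewrite !inE !eqxx !orbT /= => /orP Hd /orP Hc /esym/orP Hb /esym/orP Ha.
case: Ha => /eqP ?; case: Hb => /eqP ?; subst; [|by left|by right|].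
  by case: Hd => /eqP ->; left.
by case: Hc => /eqP ->; left.
Qed.

Lemma set2_edges (G : sgraph) (x y : G) : ([set x; y] \in edges G) = edge x y.
Proof.
apply/imsetP/idP => [[[a b]]|exy]; last by exists (x, y) => //; rewrite inE.
rewrite inE /= => eab /set2_eq [] [-> ->] //; by rewrite edge_sym.
Qed.

(** * Edge sets and their boundaries modulo 2 *)

Section Boundary.
Variable G : sgraph.
Hypothesis acG : acyclic G.
Implicit Types F : {set {set G}}.

(* A longest path of R ends in a vertex of degree at least 2, whose second
   neighbour closes a cycle. *)
Lemma even_subgraph_empty (R : rel G) :
  symmetric R -> subrel R (@edge G) ->
  (forall v, ~~ odd #|[set u | R v u]|) -> forall x y, R x y = false.
Proof.
move=> symR subR evR.
(* [k] is fuel: the path has [size p + 2] distinct vertices, so [k = 0] is contradictory. *)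
suff long k (x y : G) p : path R x (y :: p) -> uniq [:: x, y & p] ->
    #|G| <= size p + k -> False.
  move=> x y; apply/negP => Rxy.
  have xy : x != y.
    by apply/eqP => xy; have := subR _ _ Rxy; rewrite xy edge_irr.
  by apply: (long #|G| x y [::]); rewrite /= ?Rxy // inE xy.
elim: k x y p => [|k IH] x y p pth un sz.
  by have := max_card (mem [:: x, y & p]); rewrite (card_uniqP un) /= addn0 in sz *; lia.
have Rxy : R x y by case/andP: pth.
have [z Rxz zy] : exists2 z, R x z & z != y.
  have yin : y \in [set u | R x u] by rewrite inE.
  have := evR x; rewrite (cardsD1 y) yin /= negbK => od.
  have /card_gt0P [z] : 0 < #|[set u | R x u] :\ y| by apply: odd_gt0.
  by rewrite !inE => /andP [zy Rxz]; exists z.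
have xz : z != x.
  by apply/eqP => zx; have := subR _ _ Rxz; rewrite zx edge_irr.
case: (boolP (z \in p)) => [zp|zp].
  case/splitPr: zp pth un sz => p1 p2 pth un _.
  apply: (acG (c := x :: y :: rcons p1 z)); first by rewrite /= size_rcons.
  apply/andP; split.
    move: pth; rewrite /= -cat_rcons cat_path => /andP [_ /andP [pth _]].
    rewrite (subR _ _ Rxy) /= rcons_path last_rcons.
    rewrite edge_sym (subR _ _ Rxz) andbT.
    by apply: sub_path pth; apply: subR.
  have := un; rewrite -cat_rcons -[[:: x, y & _]]/([:: x; y] ++ (_ ++ _)).
  by rewrite catA cat_uniq => /andP [].
apply: (IH z x (y :: p)); last by rewrite /= addSnnS.
  by rewrite /= symR Rxz /= -/(path R x (y :: p)).
by rewrite cons_uniq un andbT !inE !negb_or xz zy.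
Qed.

(** Edge sets are read as 1-chains over the field with two elements, with [symdiff] as addition and
    [bd] as boundary map. *)
Definition bd (F : {set {set G}}) (v : G) := odd #|[set A in F | v \in A]|.
Definition symdiff (F F' : {set {set G}}) :=
  [set A | (A \in F) (+) (A \in F')].

Lemma bd_symdiff F F' v : bd (symdiff F F') v = bd F v (+) bd F' v.
Proof.
rewrite /bd -odd_card_addb; congr (odd _); apply: eq_card => A.
by rewrite !inE andb_addl.
Qed.

Lemma symdiff_sub F F' :
  F \subset edges G -> F' \subset edges G -> symdiff F F' \subset edges G.
Proof.
move=> /subsetP sF /subsetP sF'; apply/subsetP => A; rewrite inE.
by case: (boolP (A \in F)) => [/sF //|_] /=; apply: sF'.
Qed.

Lemma bd_edge x y v : edge x y -> bd [set [set x; y]] v = (v == x) (+) (v == y).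
Proof.
move=> exy; have xy : x != y by apply/eqP => xy; rewrite xy edge_irr in exy.
rewrite /bd (_ : [set A in _ | _] = if v \in [set x; y] then [set [set x; y]] else set0).
  rewrite !inE; case: (eqVneq v x) => [->|_] /=; first by rewrite cards1 (negbTE xy).
  by case: (v == y); rewrite ?cards1 ?cards0.
apply/setP => A; rewrite [LHS]inE in_set1; case: ifP => vxy; rewrite inE.
  by case: eqVneq => [->|_]; rewrite ?vxy.
by case: eqVneq => [->|_]; rewrite ?vxy.
Qed.

Lemma deg_edge_set F v : F \subset edges G ->
  #|[set A in F | v \in A]| = #|[set u | [set v; u] \in F]|.
Proof.
move=> /subsetP sF.
rewrite -(card_in_imset (f := fun u => [set v; u])).
  apply: eq_card => A; rewrite inE; apply/andP/imsetP => [[AF vA]|[u]].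
    have /imsetP [[a b]] := sF _ AF; rewrite inE /= => eab EA; subst A.
    move: vA; rewrite !inE => /orP [] /eqP ->; first by exists b => //; rewrite inE.
    by exists a; rewrite 1?inE setUC.
  by rewrite inE => uF ->; rewrite uF !inE eqxx.
move=> u u'; rewrite !inE => /sF; rewrite set2_edges => evu _ /set2_eq [[//]|[? ?]].
by subst; rewrite edge_irr in evu.
Qed.

(** The edges of [F] form a subgraph with all degrees even, which is empty by acyclicity. *)
Lemma bd_empty F : F \subset edges G -> (forall v, ~~ bd F v) -> F = set0.
Proof.
move=> sF bF; apply/eqP; rewrite -subset0; apply/subsetP => A AF.
case/imsetP: (subsetP sF _ AF) => [[a b]] /=; rewrite inE /= => eab Aab.
suff /(_ a b) : forall u v, ([set u; v] \in F) = false by rewrite -Aab AF.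
apply: even_subgraph_empty => [u v|u v|v]; first by rewrite setUC.
  by move=> /(subsetP sF); rewrite set2_edges.
by rewrite -deg_edge_set //; apply: bF.
Qed.

Lemma bd_handshake F : F \subset edges G ->
  \sum_v #|[set A in F | v \in A]| = 2 * #|F|.
Proof.
move=> sF; rewrite (eq_bigr (fun v => \sum_(A in F) (v \in A : nat))).
  rewrite exchange_big /= (eq_bigr (fun=> 2)) ?sum_nat_const 1?mulnC // => A AF.
  case/imsetP: (subsetP sF _ AF) => [[a b]] /=; rewrite inE /= => eab ->.
  rewrite -big_mkcond /= sum1_card cards2.
  by case: eqVneq eab => // ->; rewrite edge_irr.
move=> v _; rewrite -sum1_card big_mkcond [RHS]big_mkcond /=.
by apply: eq_bigr => A _; rewrite inE; case: (A \in F); case: (v \in A).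
Qed.

(** One vertex [r] may be left out: by the handshake identity the boundary at [r] is determined by
    its values elsewhere. *)
Lemma bd_inj (r : G) F F' : F \subset edges G -> F' \subset edges G ->
  (forall v, v != r -> bd F v = bd F' v) -> F = F'.
Proof.
move=> sF sF' eqb; have sD := symdiff_sub sF sF'.
have bD v : v != r -> bd (symdiff F F') v = false.
  by move=> vr; rewrite bd_symdiff eqb // addbb.
have D0 : symdiff F F' = set0.
  apply: bd_empty => // v; case: (eqVneq v r) => [->|/bD -> //].
  have := bd_handshake sD; rewrite (bigD1 r) //=.
  move=> /(congr1 odd); rewrite oddD mul2n odd_double -/(bd _ r) => H.
  suff E : odd (\sum_(i | i != r) #|[set A in symdiff F F' | i \in A]|) = false.
    by rewrite E addbF in H; rewrite H.
  by elim/big_ind: _ => [|m k om ok|i /bD] //; rewrite oddD om ok.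
apply/setP => A; have /setP/(_ A) := D0; rewrite !inE.
by case: (A \in F); case: (A \in F').
Qed.

Hypothesis conG : forall x y : G, connect (@edge G) x y.

(** Add up the edges of a walk from [x] to [r]; the boundaries telescope, and edges traversed twice
    cancel. *)
Lemma bd_path (x r : G) : exists2 F : {set {set G}}, F \subset edges G &
  forall v, bd F v = (v == x) (+) (v == r).
Proof.
have /connectP [p] := conG x r; elim: p x => [|y p IH] x /=.
  move=> _ ->; exists set0; rewrite ?sub0set // => v; rewrite addbb /bd.
  by rewrite (_ : [set A in _ | _] = set0) ?cards0 //; apply/setP => A; rewrite !inE.
case/andP=> exy pth lst; have [F sF bF] := IH _ pth lst.
exists (symdiff [set [set x; y]] F) => [|v].
  by apply: symdiff_sub; rewrite // sub1set set2_edges.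
by rewrite bd_symdiff bF bd_edge // addbA addbK.
Qed.

(** Sum the chains of [bd_path] that join the vertices of [P] to [r]. *)
Lemma bd_surj (r : G) (P : pred G) : exists2 F : {set {set G}}, F \subset edges G &
  forall v, v != r -> bd F v = P v.
Proof.
suff [F sF bF] : exists2 F : {set {set G}}, F \subset edges G &
    forall v, v != r -> bd F v = (v \in enum P).
  by exists F => // v vr; rewrite bF // mem_enum.
elim: (enum P) (enum_uniq P) => [_|x s IH /= /andP [xs /IH [F sF bF]]].
  exists set0; rewrite ?sub0set // => v _; rewrite /bd.
  by rewrite (_ : [set A in _ | _] = set0) ?cards0 //; apply/setP => A; rewrite !inE.
have [F' sF' bF'] := bd_path x r.
exists (symdiff F F') => [|v vr]; first exact: symdiff_sub.
rewrite bd_symdiff bF // bF' (negbTE vr) addbF inE.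
by case: (eqVneq v x) => [->|_]; rewrite ?(negbTE xs) // addbF.
Qed.

(** The boundary away from [r] is a bijection from sets of edges to sets of vertices other than [r];
    compare the two powers of 2. *)
Lemma card_edges_tree (r : G) : #|G| = #|edges G|.+1.
Proof.
pose f (F : {set {set G}}) := [set v in ~: [set r] | bd F v].
have : #|powerset (edges G)| = #|powerset (~: [set r])|.
  rewrite -(card_in_imset (f := f)).
    apply: eq_card => W; rewrite inE; apply/imsetP/idP => [[F _ ->]|sW].
      by apply/subsetP => v; rewrite inE => /andP [].
    have [F sF bF] := bd_surj r (mem W); exists F; first by rewrite inE.
    apply/setP => v; rewrite !inE; case: (eqVneq v r) => [->|/bF -> //].
    by apply/negbTE/negP => /(subsetP sW); rewrite !inE eqxx.
  move=> F F'; rewrite !inE => sF sF' /setP E; apply: (bd_inj (r := r)) => // v vr.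
  by have := E v; rewrite !inE vr.
rewrite !card_powerset => /eqP; rewrite eqn_exp2l // => /eqP ->.
by rewrite cardsC1 prednK //; apply/card_gt0P; exists r.
Qed.

(** Colour [x] by the parity of the chain with boundary [x + r]. For adjacent vertices these chains
    differ by exactly one edge. *)
Lemma tree_bipartite (r : G) : exists c : G -> bool,
  forall x y, edge x y -> c x = ~~ c y.
Proof.
have H x : exists F : {set {set G}}, F \subset edges G /\ forall v, bd F v = (v == x) (+) (v == r).
  by have [F] := bd_path x r; exists F.
have [F FP] := fin_all_exists H.
exists (fun x => odd #|F x|) => x y exy.
have [sx bx] := FP x; have [sy by_] := FP y.
have sxy : [set [set x; y]] \subset edges G by rewrite sub1set set2_edges.
have -> : F x = symdiff (F y) [set [set x; y]].
  apply: (bd_inj (r := r)) => //; first exact: symdiff_sub.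
  move=> v _; rewrite bd_symdiff bd_edge // bx by_.
  by case: (v == x); case: (v == y); case: (v == r).
have inset (A : {set {set G}}) : #|[set B | B \in A]| = #|A|.
  by apply: eq_card => B; rewrite inE.
by rewrite /symdiff odd_card_addb !inset cards1 addbT.
Qed.
End Boundary.

(** * Orientations with all in-degrees even *)

Definition even_orientation (G : sgraph) (D : rel G) : Prop :=
  orientation D /\ forall v, ~~ odd #|[set u | D u v]|.

Lemma orientation_sub (G : sgraph) (D : rel G) : orientation D -> subrel D (@edge G).
Proof. by move=> [oD _] u v Duv; rewrite -oD Duv. Qed.

Lemma orientation_asym (G : sgraph) (D : rel G) u v :
  orientation D -> D u v -> D v u = false.
Proof. by move=> [_ aD] Duv; have := aD u v; rewrite Duv; case: (D v u). Qed.

Lemma orientation_subrel (G : sgraph) (D D' : rel G) :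
  orientation D -> orientation D' -> subrel D D' -> D =2 D'.
Proof.
move=> oD oD' sub u v; apply/idP/idP => [/sub //|D'uv].
have : edge u v := orientation_sub oD' D'uv.
rewrite -oD.1 => /orP [//|/sub]; by rewrite (orientation_asym oD' D'uv).
Qed.

(** The edges on which [D] and [D'] disagree form a subgraph whose degree at each vertex has the
    parity of the sum of the two in-degrees, hence is even. *)
Lemma even_orientation_unique (G : sgraph) (D D' : rel G) : acyclic G ->
  even_orientation D -> even_orientation D' -> D =2 D'.
Proof.
move=> acG [[oD aD] evD] [[oD' aD'] evD'] u v.
pose R x y := D x y (+) D' x y.
have symR : symmetric R.
  move=> x y; rewrite /R; have := oD x y; rewrite -oD'.
  have := aD x y; have := aD' x y.
  by do 2!case: (D _ _); do 2!case: (D' _ _).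
suff : R u v = false by rewrite /R; case: (D u v); case: (D' u v).
apply: (even_subgraph_empty acG symR) => [x y|w].
  by rewrite /R -oD; have := oD x y; rewrite -oD'; do 2!case: (D _ _); do 2!case: (D' _ _).
have -> : [set x | R w x] = [set x | R x w] by apply/setP => x; rewrite !inE symR.
by rewrite odd_card_addb (negbTE (evD w)) (negbTE (evD' w)).
Qed.

Lemma card_arcs (G : sgraph) (D : rel G) : orientation D ->
  #|[set p : G * G | D p.1 p.2]| = #|edges G|.
Proof.
move=> oD; rewrite -(card_in_imset (f := fun p : G * G => [set p.1; p.2])).
  apply: eq_card => A; apply/imsetP/imsetP => [] [[x y]]; rewrite inE /=.
    by move=> /(orientation_sub oD) exy ->; exists (x, y); rewrite ?inE.
  rewrite -oD.1 => /orP [] Dxy ->; first by exists (x, y); rewrite ?inE.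
  by exists (y, x); rewrite ?inE // setUC.
move=> [a b] [c d]; rewrite !inE /= => Dab Dcd /set2_eq [] [? ?]; subst => //.
by rewrite (orientation_asym oD Dab) in Dcd.
Qed.

Lemma sum_indeg (V : finType) (D : rel V) :
  \sum_v #|[set u | D u v]| = #|[set p : V * V | D p.1 p.2]|.
Proof.
rewrite -sum1_card (eq_bigl (fun p : V * V => true && D p.1 p.2)); last first.
  by move=> p; rewrite inE.
rewrite -(pair_big_dep predT (fun u v => D u v) (fun _ _ => 1)) /= (exchange_big_dep predT) //=.
by apply: eq_bigr => v _; rewrite -sum1_card; apply: eq_bigl => u; rewrite inE.
Qed.

(** Reverse, in the standard orientation, a set [F] of edges whose boundary away from [r] is the
    parity of the in-degrees. The parity at [r] then follows, because the in-degrees sum to the even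
    number of edges. *)
Lemma even_orientation_exists (G : sgraph) : is_tree G -> odd #|G| ->
  exists D : rel G, even_orientation D.
Proof.
move=> [[/card_gt0P [r _] conG] acG] oddG.
pose S := @std_orientation G; have oS : orientation S := std_orientationP G.
have [F sF bF] := bd_surj conG r (fun v => odd #|[set u | S u v]|).
pose D u v := S u v (+) ([set u; v] \in F).
have FE u v : [set u; v] \in F -> edge u v.
  by move=> /(subsetP sF); rewrite set2_edges.
have oD : orientation D.
  split=> u v; rewrite /D (setUC [set v]).
    rewrite -(oS.1 u v); have := oS.2 u v; have := @FE u v; rewrite -(oS.1 u v).
    by do 2!case: (S _ _); case: (_ \in F) => //= /(_ isT).
  have := oS.2 u v; have := @FE u v; rewrite -(oS.1 u v).
  by do 2!case: (S _ _); case: (_ \in F) => //= /(_ isT).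
(* Reversing an edge changes the parity of the in-degree at both of its ends. *)
have pD v : odd #|[set u | D u v]| = odd #|[set u | S u v]| (+) bd F v.
  rewrite odd_card_addb /bd deg_edge_set //; congr (_ (+) odd _).
  by apply: eq_card => u; rewrite !inE setUC.
have evD v : v != r -> odd #|[set u | D u v]| = false.
  by move=> vr; rewrite pD bF // addbb.
exists D; split=> // v; case: (eqVneq v r) => [->|/evD -> //].
have := sum_indeg D; rewrite (card_arcs oD) (bigD1 r) //= => /(congr1 odd).
have := oddG; rewrite (card_edges_tree acG conG r) /= => /negbTE ->.
rewrite oddD => H.
suff E : odd (\sum_(i | i != r) #|[set u | D u i]|) = false.
  by rewrite E addbF in H; rewrite H.
by elim/big_ind: _ => [|m k om ok|i /evD] //; rewrite oddD om ok.
Qed.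

(** A repetition-free directed path from [y] back to [x] closes to a cycle of [G]; fewer than three
    vertices are excluded by irreflexivity and asymmetry. *)
Lemma orientation_acyclic (G : sgraph) (D : rel G) x y : acyclic G ->
  orientation D -> D x y -> ~~ connect D y x.
Proof.
move=> acG oD Dxy; apply/negP => /connectP [p0 pth0 lst0].
case/shortenP: pth0 lst0 => p pth un _ lst.
have exy := orientation_sub oD Dxy.
case: p pth un lst => [|a [|b p]] pth un lst.
- by rewrite lst edge_irr in exy.
- by move: pth lst; rewrite /= andbT => Dya xa; rewrite -xa (orientation_asym oD Dxy) in Dya.
- apply: (acG [:: y, a, b & p]) => //; apply/andP; split=> //.
  rewrite (_ : cycle _ _ = path (@edge G) y (rcons [:: a, b & p] y)) //.
  rewrite rcons_path -lst exy andbT.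
  by apply: sub_path pth; apply: orientation_sub.
Qed.

Lemma mem_uniq_full (T : finType) (s : seq T) x :
  uniq s -> size s = #|T| -> x \in s.
Proof.
move=> us sz; have [||_ ->] := uniq_min_size us (s2 := enum T).
- by move=> y _; rewrite mem_enum.
- by rewrite sz -cardE.
- by rewrite mem_enum.
Qed.

(** * Even sequences as lists *)

Section Lists.
Variable G : sgraph.
Implicit Types (s t : seq G).

Fixpoint edge_count t :=
  if t is x :: t' then count (edge x) t' + edge_count t' else 0.

(* The lists are read backwards: the head is the last vertex of the sequence. *)
Fixpoint rev_even t :=
  if t is x :: t' then ~~ odd (count (edge x) t') && rev_even t' else true.

Lemma card_uniq_count t (P : pred G) : uniq t ->
  #|[set y | (y \in t) && P y]| = count P t.
Proof.
move=> ut; rewrite -size_filter -(card_uniqP (filter_uniq P ut)).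
by apply: eq_card => y; rewrite inE mem_filter andbC.
Qed.

(** Split the induced edges by whether they contain the head of the list. *)
Lemma card_induced_edges t : uniq t ->
  #|induced_edges [set x in t]| = edge_count t.
Proof.
elim: t => [_|x t IH /= /andP [xt ut]] /=.
  apply/eqP; rewrite cards_eq0 -subset0; apply/subsetP => A.
  rewrite !inE => /andP [/imsetP [[a b]] _ ->] /subsetP /(_ a).
  by rewrite !inE eqxx => /(_ isT).
rewrite -(cardsID [set A : {set G} | x \in A]); congr (_ + _).
  rewrite -(card_uniq_count _ ut).
  rewrite -(card_in_imset (f := fun u => [set x; u])); last first.
    move=> u u'; rewrite !inE => /andP [ut' _] _ /set2_eq [[//]|[? ?]].
    by subst u; rewrite ut' in xt.
  apply: eq_card => A; rewrite !inE; apply/andP/imsetP => [[]|[u]].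
    case/andP=> /imsetP [[a b]]; rewrite !inE /= => eab -> /subsetP sA.
    have := sA a; have := sA b; rewrite !inE !eqxx orbT /= => /(_ isT) Hb /(_ isT) Ha.
    have ab : a != b by apply/eqP => ab; rewrite ab edge_irr in eab.
    case/orP=> /eqP ?; subst x.
      by exists b => //; rewrite inE eab andbT; case/orP: Hb => // /eqP; move/eqP: ab => ab /esym.
    exists a; rewrite 1?setUC // inE edge_sym eab andbT.
    by case/orP: Ha => // /eqP; move/eqP: ab.
  rewrite inE => /andP [ut' exu] ->; rewrite set2_edges exu !inE eqxx; split=> //.
  by apply/subsetP => z; rewrite !inE => /orP [/eqP ->|/eqP ->]; rewrite ?eqxx ?ut' ?orbT.
rewrite -IH //; apply: eq_card => A; rewrite !inE; case: (A \in _) => //=; rewrite ?andbF //.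
apply/andP/subsetP => [[xA /subsetP sA] z zA|sA].
  by have := sA z zA; rewrite !inE => /orP [/eqP zx|//]; rewrite -zx zA in xA.
split; first by apply/negP => /sA; rewrite inE (negbTE xt).
by apply/subsetP => z /sA; rewrite !inE => ->; rewrite orbT.
Qed.

Lemma edge_count_perm s t : uniq s -> perm_eq t s -> edge_count t = edge_count s.
Proof.
move=> us pst; rewrite -!card_induced_edges ?(perm_uniq pst) //.
by congr #|induced_edges _|; apply/setP => x; rewrite !inE (perm_mem pst).
Qed.

Lemma edge_count_rem s x : uniq s -> x \in s ->
  edge_count s = count (edge x) (rem x s) + edge_count (rem x s).
Proof.
by move=> us xs; rewrite -(edge_count_perm (t := x :: rem x s) us) // perm_sym perm_to_rem.
Qed.

Lemma rev_even_count t : rev_even t -> ~~ odd (edge_count t).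
Proof. by elim: t => //= x t IH /andP [c /IH ev]; rewrite oddD (negbTE c). Qed.

(** All partial edge counts are even exactly when all increments are. *)
Lemma rev_evenP t :
  reflect (forall i, ~~ odd (edge_count (drop i t))) (rev_even t).
Proof.
apply: (iffP idP) => [ev i|].
  apply: rev_even_count; elim: t ev i => [|x t IH] //= /andP [c ev] [|i] /=.
    by rewrite c ev.
  exact: IH.
elim: t => //= x t IH H; rewrite IH => [|i]; last by have := H i.+1.
have := H 0; have := H 1; rewrite /= drop0 oddD andbT.
by case: (odd (edge_count t)); rewrite ?addbF.
Qed.

Lemma even_sequenceE (s : #|G|.-tuple G) :
  even_sequence s = uniq s && rev_even (rev s).
Proof.
rewrite /even_sequence; case: (boolP (uniq s)) => //= us.
have E i : #|induced_edges [set x in take i s]| =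
           edge_count (drop (#|G| - i) (rev s)).
  rewrite -card_induced_edges ?drop_uniq ?rev_uniq //.
  congr #|induced_edges _|; apply/setP => x; rewrite !inE.
  by rewrite -{2}(size_tuple s) -rev_take mem_rev.
apply/forallP/rev_evenP => [H i|H i]; last by rewrite E.
(* [rev_evenP] ranges over all [i]; past the length the suffix is empty. *)
case: (leqP i #|G|) => iG; last first.
  by rewrite drop_oversize // size_rev size_tuple ltnW.
have iG' : #|G| - i < #|G|.+1 by rewrite ltnS leq_subr.
by have := H (Ordinal iG'); rewrite E /= subKn.
Qed.

Lemma eta_count : eta G = count rev_even (permutations (enum G)).
Proof.
rewrite /eta cardE -(size_map (fun s : #|G|.-tuple G => rev s)) -size_filter.
apply: perm_size; apply: uniq_perm.
- by rewrite map_inj_uniq ?enum_uniq // => s t /(inv_inj revK) /val_inj.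
- exact/filter_uniq/permutations_uniq.
move=> t; rewrite mem_filter mem_permutations; apply/mapP/andP => [[s]|[ev pt]].
  rewrite mem_enum inE even_sequenceE => /andP [us ev] ->; split=> //.
  rewrite perm_rev uniq_perm ?enum_uniq // => x; rewrite mem_enum.
  by rewrite (mem_uniq_full _ us) ?size_tuple.
have sz : size (rev t) == #|G| by rewrite size_rev (perm_size pt) -cardE.
exists (Tuple sz); last by rewrite /= revK.
by rewrite mem_enum inE even_sequenceE /= rev_uniq (perm_uniq pt) enum_uniq revK.
Qed.

End Lists.

(** Splitting by the head of the list drives the recursions both for the alternating sum and for
    counting linear extensions. *)
Lemma big_permutations (R : Type) (idx : R) (op : Monoid.com_law idx)
    (T : eqType) (s : seq T) (F : seq T -> R) : uniq s -> 0 < size s ->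
  \big[op/idx]_(t <- permutations s) F t =
  \big[op/idx]_(x <- s) \big[op/idx]_(t <- permutations (rem x s)) F (x :: t).
Proof.
move=> us s0; rewrite (perm_big _ (permutationsE s0)) /= undup_id //.
by rewrite big_allpairs_dep.
Qed.

(** * The alternating sum counts even sequences *)

Section Signed.
Import GRing.Theory.
Variables (G : sgraph) (D : rel G).
Hypothesis oD : orientation D.
Implicit Types (s t : seq G).

(** Here lists are read forwards: the index in the list is the value of the bijection, and an arc is
    a descent when its tail comes after its head. *)
Fixpoint descents t :=
  if t is x :: t' then count (D^~ x) t' + descents t' else 0.

Lemma descents_rcons t x : descents (rcons t x) = descents t + count (D x) t.
Proof.
elim: t => //= y t ->; rewrite -cats1 count_cat /= addn0; lia.
Qed.

(** Each edge is a descent in exactly one of the two orders. *)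
Lemma descents_rev t : descents (rev t) + descents t = edge_count t.
Proof.
elim: t => //= x t IH; rewrite rev_cons descents_rcons count_rev -IH.
have -> : count (edge x) t = count (D x) t + count (D^~ x) t; last by lia.
elim: t {IH} => //= y t ->; rewrite -oD.1; have := oD.2 x y.
by case: (D x y); case: (D y x) => //= _; lia.
Qed.

Local Open Scope ring_scope.

Definition signed_sum s : int := \sum_(t <- permutations s) (-1) ^+ descents t.

Lemma signed_sum_odd s : uniq s -> odd (edge_count s) -> signed_sum s = 0.
Proof.
move=> us os; have prm : perm_eq [seq rev t | t <- permutations s] (permutations s).
  apply: uniq_perm; rewrite ?permutations_uniq //.
    by rewrite map_inj_uniq ?permutations_uniq //; apply: inv_inj revK.
  move=> t; rewrite -{1}(revK t) mem_map; last exact: inv_inj revK.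
  by rewrite !mem_permutations perm_rev.
suff : signed_sum s = - signed_sum s by lia.
rewrite {1}/signed_sum -(perm_big _ prm) big_map /= -sumrN.
rewrite big_seq [RHS]big_seq; apply: eq_bigr => t; rewrite mem_permutations => pt.
rewrite -(signr_odd _ (descents (rev t))) -(signr_odd _ (descents t)).
have := descents_rev t; rewrite (edge_count_perm us pt) => /(congr1 odd).
by rewrite oddD os; case: (odd _); case: (odd _).
Qed.

(* Only the terms whose first vertex has even degree survive, by the vanishing
   for an odd number of edges, and there all signs are positive. *)
Lemma signed_sum_bipartite (c : G -> bool) s :
  (forall x y, D x y -> c x && ~~ c y) -> uniq s ->
  signed_sum s = (count (@rev_even G) (permutations s))%:R.
Proof.
move=> bip; move Dn: (size s) => n; elim: n s Dn => [|n IH] s Dn us.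
  by rewrite (size0nil Dn) /signed_sum /= big_seq1.
case: (boolP (odd (edge_count s))) => os.
  rewrite signed_sum_odd // (eq_in_count (a2 := pred0)) ?count_pred0 // => t.
  rewrite mem_permutations => pt; apply/negP => /rev_even_count.
  by rewrite (edge_count_perm us pt) os.
rewrite /signed_sum -sum1_count [in RHS]big_mkcond.
rewrite big_permutations ?Dn // big_permutations ?Dn //= natr_sum.
rewrite big_seq [RHS]big_seq; apply: eq_bigr => x xs.
have ur := rem_uniq x us; have sr : size (rem x s) = n by rewrite size_rem ?Dn.
have ecr := edge_count_rem us xs.
have -> : \sum_(t <- permutations (rem x s)) (-1) ^+ (count (D^~ x) t + descents t)
    = (-1) ^+ count (D^~ x) (rem x s) * signed_sum (rem x s).
  rewrite mulr_sumr big_seq [RHS]big_seq; apply: eq_bigr => t.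
  by rewrite mem_permutations => /permP ->; rewrite exprD.
have -> : (\sum_(t <- permutations (rem x s))
      if ~~ odd (count (edge x) t) && rev_even t then 1 else 0)%N =
    (~~ odd (count (edge x) (rem x s)) * count (@rev_even G) (permutations (rem x s)))%N.
  rewrite -(sum1_count _ (@rev_even G)) [in RHS]big_mkcond big_distrr /= big_seq [RHS]big_seq.
  apply: eq_bigr => t; rewrite mem_permutations => /permP ->.
  by case: (odd _); case: (rev_even t).
(* The total is even, so if [x] has odd degree then an odd number of edges remains and the inner sum
   vanishes. *)
case: (boolP (odd (count (edge x) (rem x s)))) => ox.
  rewrite mul0n signed_sum_odd ?mulr0 //.
  by move: os; rewrite ecr oddD ox /= negbK.
rewrite mul1n IH // -signr_odd.
(* Either no arc enters [x], or all edges at [x] enter it, and their number is even. *)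
suff -> : odd (count (D^~ x) (rem x s)) = false by rewrite mul1r.
case cx: (c x).
  rewrite (eq_count (a2 := pred0)) ?count_pred0 // => y.
  by apply/negP => /bip; rewrite cx andbF.
rewrite (eq_count (a2 := edge x)) ?(negbTE ox) // => y.
rewrite -oD.1 orbC; case: (boolP (D x y)) => [/bip|_]; first by rewrite cx.
by rewrite orbF.
Qed.

(** In this form the order of summation is immaterial, so the sums over [t] can be exchanged for
    sums over all vertices. *)
Lemma sum_descents t : uniq t ->
  (\sum_(v <- t) \sum_(u <- t) (D u v && (index v t < index u t)) = descents t)%N.
Proof.
elim: t => [|x t IH] /=; first by rewrite big_nil.
case/andP=> xt ut; rewrite big_cons; congr (_ + _)%N.
  rewrite big_cons eqxx ltnn andbF add0n -sum1_count [RHS]big_mkcond.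
  rewrite big_seq [RHS]big_seq; apply: eq_bigr => u ut'.
  case: eqVneq => [xu|_]; first by rewrite xu ut' in xt.
  by rewrite andbT; case: (D u x).
rewrite -IH // big_seq [RHS]big_seq; apply: eq_bigr => v vt.
rewrite big_cons eqxx ltn0 andbF add0n big_seq [RHS]big_seq; apply: eq_bigr => u ut'.
case: eqVneq => [xv|_]; first by rewrite xv vt in xt.
by case: eqVneq => [xu|_]; first by rewrite xu ut' in xt.
Qed.

(** Sending a repetition-free tuple to its index function is injective, and surjective onto the
    injective functions by counting. *)
Lemma Apoly_signed_sum : (Apoly D).[-1] = signed_sum (enum G).
Proof.
(* The default [enum_rank v] is never taken on [A], where every index is in range. *)
pose sg (t : #|G|.-tuple G) : {ffun G -> 'I_#|G|} :=
  [ffun v => insubd (enum_rank v) (index v t)].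
pose A := [set t : #|G|.-tuple G | all predT t & uniq t].
have full (t : #|G|.-tuple G) : t \in A -> forall v, v \in t.
  by rewrite inE => /andP [_ ut] v; rewrite mem_uniq_full ?size_tuple.
have sgE (t : #|G|.-tuple G) v : t \in A -> sg t v = index v t :> nat.
  move=> tA; rewrite ffunE val_insubd.
  by rewrite -[X in (_ < X)%N](size_tuple t) index_mem full.
have sgI : {in A &, injective sg}.
  move=> t t' tA t'A E; apply: val_inj => /=.
  (* [nth] needs a default vertex; without any vertex both tuples are empty. *)
  case: (pickP (mem G)) => [x0 _|G0]; last first.
    by case: t tA E => [[|x ?] ?]; [case: t' t'A => [[|x ?] ?]//; have := G0 x
      | have := G0 x].
  apply: (@eq_from_nth _ x0); rewrite ?size_tuple // => i iG.
  have ut : uniq t by move: tA; rewrite inE => /andP [].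
  have := sgE _ (nth x0 t i) t'A; rewrite -E sgE // index_uniq ?size_tuple // => iE.
  by rewrite [in RHS]iE nth_index // full.
have im : sg @: A = [set f : {ffun G -> 'I_#|G|} | injectiveb f].
  apply/eqP; rewrite eqEcard card_in_imset // card_inj_ffuns card_uniq_tuples.
  rewrite card_ord leqnn andbT; apply/subsetP => f /imsetP [t tA ->].
  rewrite inE; apply/injectiveP => u v /(congr1 val) /=; rewrite !sgE //.
  by move=> E; rewrite -(nth_index u (full _ tA u)) E nth_index // full.
rewrite /Apoly horner_sum (eq_bigl (fun f => f \in sg @: A)); last first.
  by move=> f; rewrite im inE.
rewrite big_imset //= /signed_sum.
have prm : perm_eq [seq (t : seq G) | t : #|G|.-tuple G <- enum A] (permutations (enum G)).
  apply: uniq_perm; rewrite ?permutations_uniq //.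
    by rewrite map_inj_uniq ?enum_uniq //; apply: val_inj.
  move=> t; rewrite mem_permutations; apply/mapP/idP => [[t' t'A ->]|pt].
    rewrite mem_enum in t'A; have ut : uniq t' by move: t'A; rewrite inE => /andP [].
    by apply: uniq_perm; rewrite ?enum_uniq // => v; rewrite mem_enum full.
  have sz : size t == #|G| by rewrite (perm_size pt) -cardE.
  exists (Tuple sz) => //; rewrite mem_enum inE /= all_predT.
  by rewrite (perm_uniq pt) enum_uniq.
rewrite -(perm_big _ prm) big_map big_enum /=; apply: eq_bigr => t tA.
have ut : uniq t by move: tA; rewrite inE => /andP [].
have pt : perm_eq t (enum G).
  by apply: uniq_perm; rewrite ?enum_uniq // => v; rewrite mem_enum full.
rewrite hornerXn; congr (_ ^+ _); rewrite -sum_descents //.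
rewrite (perm_big _ pt) big_enum /=.
under eq_bigr do rewrite (perm_big _ pt) big_enum /=.
rewrite /des -(sum_indeg (fun u v => D u v && (sg t v < sg t u)%N)).
apply: eq_bigr => v _; rewrite -sum1_card big_mkcond; apply: eq_bigr => u _.
by rewrite inE !sgE //; case: (D u v); case: (_ < _)%N.
Qed.

End Signed.

Lemma nu_eta (G : sgraph) : is_tree G -> nu G = eta G.
Proof.
move=> [[/card_gt0P [r _] conG] acG]; have [c cP] := tree_bipartite acG conG r.
pose D u v := [&& edge u v, c u & ~~ c v].
have oD : orientation D.
  split=> u v; rewrite /D.
    rewrite (edge_sym v u); case: (boolP (edge u v)) => //= /cP ->.
    by case: (c v).
  by case: (c u); rewrite ?andbF.
rewrite -(nuE oD) Apoly_signed_sum (signed_sum_bipartite oD (c := c)) ?enum_uniq //.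
  by rewrite eta_count natz.
by move=> x y /and3P [_ -> ->].
Qed.

(** * Linear extensions of an acyclic digraph *)

(* As above, the lists are read backwards: arcs point to earlier entries. *)
Definition linear_ext (V : eqType) (D : rel V) := pairwise (fun x y => ~~ D x y).

Section Hooks.
Variables (V : finType) (D : rel V).
Hypothesis acD : forall x y, D x y -> ~~ connect D y x.
Implicit Types (s t : seq V).

Definition hook v := #|[set u | connect D u v]|.
(** The sinks of [s] are the possible heads of its linear extensions. *)
Definition sink s x := all (fun z => ~~ D x z) s.
Definition down_closed s := forall x y, D x y -> y \in s -> x \in s.

Lemma acyclic_irr x : D x x = false.
Proof. by apply/negP => /acD; rewrite connect0. Qed.

Lemma hook_gt0 x : 0 < hook x.
Proof. by apply/card_gt0P; exists x; rewrite inE connect0. Qed.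

Lemma hook_lt x y : D x y -> hook x < hook y.
Proof.
move=> Dxy; apply: proper_card; apply/properP; split.
  by apply/subsetP => u; rewrite !inE => ux; apply: connect_trans ux (connect1 Dxy).
by exists y; rewrite !inE ?connect0 // acD.
Qed.

Lemma hook_le x y : connect D x y -> hook x <= hook y.
Proof.
move=> xy; apply: subset_leq_card; apply/subsetP => u; rewrite !inE => ux.
exact: connect_trans ux xy.
Qed.

Lemma connect_step x y : connect D x y -> x != y -> exists2 z, D x z & connect D z y.
Proof.
case/connectP=> [[|z p]] /=; first by move=> _ ->; rewrite eqxx.
by case/andP=> Dxz pth -> _; exists z => //; apply/connectP; exists p.
Qed.

Lemma down_closed_connect s x y :
  down_closed s -> connect D x y -> y \in s -> x \in s.
Proof.
move=> cs /connectP [p]; elim: p x => [|z p IH] x /=; first by move=> _ ->.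
by case/andP=> Dxz pth lst ys; apply: cs Dxz _; apply: IH.
Qed.

(** Take a vertex of [s] above [y] with the largest hook; hooks increase strictly along arcs. *)
Lemma exists_sink s y : y \in s ->
  exists x, [/\ x \in s, connect D y x & sink s x].
Proof.
move=> ys; pose P x := (x \in s) && connect D y x.
have Py : P y by rewrite /P ys connect0.
case: (arg_maxnP hook Py) => x /andP [xs yx] mx; exists x; split=> //.
apply/allP => z zs; apply/negP => Dxz.
have /mx : P z by rewrite /P zs (connect_trans yx (connect1 Dxz)).
by rewrite /= leqNgt hook_lt.
Qed.

Lemma down_closed_rem s x :
  uniq s -> down_closed s -> sink s x -> down_closed (rem x s).
Proof.
move=> us cs /allP sx a b Dab; rewrite !(mem_rem_uniq _ us) !inE => /andP [bx bs].
rewrite (cs _ _ Dab bs) andbT; apply/eqP => ax.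
by have := sx b bs; rewrite -ax Dab.
Qed.

(** Double count the pairs of a sink [x] and a vertex [y] below it; as [s] is down-closed, it
    contains the whole hook of [x]. *)
Lemma sum_sink_hooks s : uniq s -> down_closed s ->
  \sum_(x <- s | sink s x) hook x =
  \sum_(y <- s) count (fun x => sink s x && connect D y x) s.
Proof.
move=> us cs.
rewrite [RHS](eq_bigr (fun y => \sum_(x <- s | sink s x) connect D y x)); last first.
  move=> y _; rewrite -sum1_count big_mkcond [RHS]big_mkcond /=.
  by apply: eq_bigr => x _; case: (sink s x); case: (connect D y x).
rewrite exchange_big /= big_seq_cond [RHS]big_seq_cond.
apply: eq_bigr => x /andP [xs _]; rewrite /hook -big_mkcond /= sum1_count.
rewrite -size_filter -(card_uniqP (filter_uniq _ us)); apply: eq_card => u.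
rewrite inE mem_filter; case: (boolP (connect D u x)) => //= ux.
by rewrite (down_closed_connect cs ux xs).
Qed.

(** Condition on the head, which must be a sink. The product of hooks is kept as a factor to avoid
    division. *)
Lemma count_linear_ext_rec s : uniq s -> 0 < size s ->
  count (linear_ext D) (permutations s) * \prod_(v <- s) hook v =
  \sum_(x <- s | sink s x) hook x *
    (count (linear_ext D) (permutations (rem x s)) * \prod_(v <- rem x s) hook v).
Proof.
move=> us s0; rewrite -sum1_count [in LHS]big_mkcond big_permutations //=.
rewrite big_distrl /= [RHS]big_mkcond big_seq [RHS]big_seq; apply: eq_bigr => x xs.
rewrite [\prod_(v <- s) _](perm_big _ (perm_to_rem xs)) big_cons /=.
rewrite (_ : \sum_(t <- _) _ = sink s x * count (linear_ext D) (permutations (rem x s))).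
  by case: (sink s x); rewrite ?mul0n // mul1n mulnCA.
rewrite -sum1_count [in RHS]big_mkcond big_distrr /= big_seq [RHS]big_seq.
apply: eq_bigr => t; rewrite mem_permutations => pt; rewrite /linear_ext /=.
rewrite (perm_all _ pt) /sink (perm_all _ (perm_to_rem xs)) /= acyclic_irr /=.
by case: all; case: pairwise.
Qed.

(** Every vertex lies below at least one sink, so the hooks of the sinks sum to at least
    [size s]. *)
Lemma hook_bound s : uniq s -> down_closed s ->
  (size s)`! <= count (linear_ext D) (permutations s) * \prod_(v <- s) hook v.
Proof.
move Dn: (size s) => n; elim: n s Dn => [|n IH] s Dn us cs.
  by rewrite (size0nil Dn) big_nil.
rewrite count_linear_ext_rec ?Dn // factS.
apply: (@leq_trans (\sum_(x <- s | sink s x) hook x * n`!)).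
  rewrite -big_distrl leq_mul2r sum_sink_hooks //; apply/orP; right.
  rewrite -Dn -sum1_size big_seq [X in _ <= X]big_seq.
  apply: leq_sum => y ys; rewrite -has_count; apply/hasP.
  by have [x [xs yx sx]] := exists_sink ys; exists x => //; rewrite sx.
rewrite big_seq_cond [X in _ <= X]big_seq_cond; apply: leq_sum => x /andP [xs sx].
rewrite leq_mul2l IH ?orbT ?rem_uniq ?size_rem ?Dn //.
exact: down_closed_rem.
Qed.

Hypothesis out1 : forall x y z, D x y -> D x z -> y = z.

(** With out-degrees at most 1, the vertices reachable from [a] form a chain. *)
Lemma connect_comparable a x y : connect D a x -> connect D a y ->
  connect D x y || connect D y x.
Proof.
case/connectP=> p; elim: p a => [|b p IH] a /=; first by move=> _ -> ->.
case/andP=> Dab pth lst ay.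
case: (eqVneq a y) => [<-|ay'].
  apply/orP; right; apply: connect_trans (connect1 Dab) _.
  by apply/connectP; exists p.
by have [z Daz zy] := connect_step ay ay'; apply: (IH b) => //; rewrite (out1 Dab Daz).
Qed.

Lemma sink_connect s x y : down_closed s -> sink s x -> y \in s ->
  connect D x y -> x = y.
Proof.
move=> cs /allP sx ys xy; apply/eqP/negPn/negP => xy'.
have [z Dxz zy] := connect_step xy xy'.
by have := sx z (down_closed_connect cs zy ys); rewrite Dxz.
Qed.

(** The hook length formula for rooted forests: every vertex now lies below exactly one sink, so
    [hook_bound] becomes an equality. *)
Lemma hook_formula s : uniq s -> down_closed s ->
  count (linear_ext D) (permutations s) * \prod_(v <- s) hook v = (size s)`!.
Proof.
move Dn: (size s) => n; elim: n s Dn => [|n IH] s Dn us cs.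
  by rewrite (size0nil Dn) big_nil.
rewrite count_linear_ext_rec ?Dn // factS.
rewrite big_seq_cond (eq_bigr (fun x => hook x * n`!)) -?big_seq_cond; last first.
  move=> x /andP [xs sx]; rewrite IH ?rem_uniq ?size_rem ?Dn //.
  exact: down_closed_rem.
rewrite -big_distrl sum_sink_hooks //; congr (_ * _).
rewrite -Dn -sum1_size big_seq [RHS]big_seq.
apply: eq_bigr => y ys; have [x [xs yx sx]] := exists_sink ys.
rewrite (eq_in_count (a2 := pred1 x)) ?count_uniq_mem ?xs // => z zs /=.
case: eqVneq => [->|zx]; first by rewrite sx yx.
apply/negP => /andP [sz yz]; case/eqP: zx.
case/orP: (connect_comparable yx yz) => [xz|zx]; last exact: (sink_connect cs sz xs zx).
by rewrite (sink_connect cs sx zs xz).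
Qed.

End Hooks.

(** * Even sequences as linear extensions *)

Section LinearExt.
Variables (G : sgraph) (D : rel G).
Hypothesis oD : orientation D.
Implicit Types (s t : seq G).

Lemma rev_even_all t : uniq t -> rev_even t =
  all (fun v => ~~ odd (count (fun u => edge u v && (index v t < index u t)) t)) t.
Proof.
elim: t => //= x t IH /andP [xt ut]; rewrite !eqxx edge_irr add0n; congr (_ && _).
  congr (~~ odd _); apply: eq_in_count => u ut'; rewrite edge_sym.
  by case: eqVneq => [xu|_]; [rewrite xu ut' in xt | rewrite andbT].
rewrite IH //; apply: eq_in_all => v vt.
have -> : (x == v) = false by apply/eqP => xv; rewrite xv vt in xt.
rewrite ltn0 andbF add0n; congr (~~ odd _); apply: eq_in_count => u ut'.
by case: eqVneq => [xu|_ //]; rewrite xu ut' in xt.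
Qed.

(** Direct every edge towards its end nearer to the head of [t]. The list is even exactly when this
    orientation [Dt] is, hence by uniqueness when [Dt] is [D]. *)
Lemma rev_even_linear_ext t : acyclic G -> (forall v, ~~ odd #|[set u | D u v]|) ->
  perm_eq t (enum G) -> rev_even t = linear_ext D t.
Proof.
move=> acG evD pt.
have ut : uniq t by rewrite (perm_uniq pt) enum_uniq.
have full v : v \in t by rewrite (perm_mem pt) mem_enum.
pose Dt u v := edge u v && (index v t < index u t).
have oDt : orientation Dt.
  split=> u v; rewrite /Dt (edge_sym v u).
    case: (boolP (edge u v)) => //= euv; rewrite -neq_ltn.
    by apply: contraTneq euv => /index_inj -> //; rewrite edge_irr.
  by case: (edge u v) => //=; case: ltngtP.
have evE : rev_even t = [forall v, ~~ odd #|[set u | Dt u v]|].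
  rewrite rev_even_all //; apply/allP/forallP => H v; have := H v.
    rewrite full => /(_ isT); rewrite -card_uniq_count // => H'.
    by rewrite (eq_card (B := [set y | (y \in t) && Dt y v])) // => u; rewrite !inE full.
  move=> H' _; rewrite -card_uniq_count //.
  by rewrite (eq_card (B := [set u | Dt u v])) // => u; rewrite !inE full.
have linE : linear_ext D t -> subrel D Dt.
  move=> /(pairwiseP) lt u v Duv; rewrite /Dt (orientation_sub oD Duv) /=.
  rewrite ltnNge leq_eqVlt negb_or; apply/andP; split.
    apply: contraTneq (orientation_sub oD Duv) => /index_inj -> //.
    by rewrite edge_irr.
  apply/negP => iuv; have := lt u (index u t) (index v t).
  by rewrite !inE !index_mem !full => /(_ isT isT iuv); rewrite !nth_index // Duv.
apply/idP/idP => [|lt]; rewrite evE.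
  move=> /forallP ev; have E := even_orientation_unique acG (conj oD evD) (conj oDt ev).
  have [->|/hasP [x0 _ _]] // : t = [::] \/ has predT t by case: (t); [left | right].
  apply/(pairwiseP x0) => i j; rewrite !inE => it jt ij; rewrite E /Dt.
  by rewrite !index_uniq // ltnNge (ltnW ij) andbF.
have E := orientation_subrel oD oDt (linE lt).
apply/forallP => v; rewrite (eq_card (B := [set u | D u v])) ?evD // => u.
by rewrite !inE E.
Qed.
End LinearExt.

(** * The product of the hooks *)

(** The double factorial [(2n+1)!!], without its factor 1. *)
Definition odd_fact n := \prod_(i < n) (2 * i + 3).

Lemma odd_factS n : odd_fact n.+1 = odd_fact n * (2 * n + 3).
Proof. by rewrite /odd_fact big_ord_recr. Qed.

Lemma odd_fact_gt0 n : 0 < odd_fact n.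
Proof. by apply: prodn_gt0 => i; rewrite addn3. Qed.

Lemma odd_fact_le m n : m <= n -> odd_fact m <= odd_fact n.
Proof.
move=> /subnK <-; elim: (n - m) => // k IH; rewrite addSn odd_factS.
by apply: leq_trans IH _; rewrite leq_pmulr // addn3.
Qed.

Lemma odd_fact_lt m n : m < n -> odd_fact m < odd_fact n.
Proof.
move=> mn; apply: leq_trans (odd_fact_le mn); rewrite odd_factS.
by rewrite ltn_Pmulr ?odd_fact_gt0 // addn3.
Qed.

(** Since [n! * 2^n] is [(2n)!!], this separates odd from even factors. *)
Lemma odd_fact_double n : odd_fact n * (n`! * 2 ^ n) = (2 * n).+1`!.
Proof.
elim: n => [|n IH]; first by rewrite /odd_fact big_ord0.
rewrite (_ : (2 * n.+1).+1 = (2 * n).+3); last by lia.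
rewrite (factS (2 * n).+2) (factS (2 * n).+1) -IH odd_factS factS expnS.
by move: (odd_fact n) (n`!) (2 ^ n) => a b c; lia.
Qed.

Section HookProduct.
Variables (V : finType) (D : rel V).
Hypothesis acD : forall x y, D x y -> ~~ connect D y x.
Hypothesis evD : forall v, ~~ odd #|[set u | D u v]|.
Implicit Types (s t : seq V).

Definition half_indeg v := #|[set u | D u v]|./2.

Lemma indegE v : #|[set u | D u v]| = 2 * half_indeg v.
Proof. by rewrite -[LHS]odd_double_half (negbTE (evD v)) mul2n. Qed.

Lemma half_indeg_gt0 u v : D u v -> 0 < half_indeg v.
Proof.
move=> Duv; suff : 0 < #|[set u | D u v]| by rewrite indegE; lia.
by apply/card_gt0P; exists u; rewrite inE.
Qed.

Lemma connect_last_step x y : connect D x y -> x != y ->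
  exists2 z, connect D x z & D z y.
Proof.
case/connectP=> p; case/lastP: p => [|p z]; first by move=> _ ->; rewrite eqxx.
rewrite rcons_path last_rcons => /andP [pth Dz] -> _.
by exists (last x p) => //; apply/connectP; exists p.
Qed.

Lemma connect_source x y : half_indeg y = 0 -> connect D x y -> x = y.
Proof.
move=> y0 xy; apply/eqP/negPn/negP => /(connect_last_step xy) [z _ Dzy].
by have := half_indeg_gt0 Dzy; rewrite y0.
Qed.

Lemma hook_source v : half_indeg v = 0 -> hook D v = 1.
Proof.
move=> v0; rewrite /hook (_ : [set u | _] = [set v]) ?cards1 //.
apply/setP => u; rewrite !inE; apply/idP/eqP => [/(connect_source v0) //|->].
exact: connect0.
Qed.

(* Each vertex below x other than x is the tail of an arc below x. *)
Lemma hook_indeg x : hook D x <= (2 * \sum_(b | connect D b x) half_indeg b).+1.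
Proof.
rewrite /hook (cardsD1 x) inE connect0 add1n ltnS.
(* For [u] below [x] and distinct from it, [next u] is the head of an arc that starts a path to [x];
   the default is not reached. *)
pose next u := odflt u [pick z | D u z && connect D z x].
rewrite -(card_imset (f := fun u => (u, next u))); last by move=> u u' [].
apply: (@leq_trans #|[set p : V * V | D p.1 p.2 && connect D p.2 x]|).
  apply: subset_leq_card; apply/subsetP => _ /imsetP [u + ->].
  rewrite !inE => /andP [ux cux] /=; rewrite /next; case: pickP => [//|H].
  by have [z Duz zx] := connect_step cux ux; have := H z; rewrite Duz zx.
rewrite -(sum_indeg (fun u v => D u v && connect D v x)) big_distrr [X in _ <= X]big_mkcond /=.
apply: leq_sum => b _; case: ifP => bx.
  by rewrite -indegE; apply: subset_leq_card; apply/subsetP => u; rewrite !inE andbT.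
by rewrite leqn0 cards_eq0; apply/eqP/setP => u; rewrite !inE andbF.
Qed.

Lemma hook_le_sum x t : uniq t -> down_closed D t -> x \in t ->
  hook D x <= (2 * \sum_(b <- t) half_indeg b).+1.
Proof.
move=> ut ct xt; apply: leq_trans (hook_indeg x) _; rewrite ltnS leq_mul2l /=.
rewrite [X in _ <= X]big_uniq //= big_mkcond [X in _ <= X]big_mkcond /=.
apply: leq_sum => b _; case: ifP => // bx.
by rewrite (down_closed_connect ct bx xt).
Qed.

Lemma linear_ext_behead x t : uniq (x :: t) -> down_closed D (x :: t) ->
  linear_ext D (x :: t) -> [/\ uniq t, down_closed D t & linear_ext D t].
Proof.
move=> ut ct lt; split; [by case/andP: ut| |by case/andP: lt].
have := down_closed_rem ut ct (x := x); rewrite /= eqxx; apply.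
by rewrite /sink /= (acyclic_irr acD); case/andP: lt.
Qed.

(** Add the vertices from the end of the list. A source has hook 1; a vertex of in-degree [2 * k.+1]
    has hook at most the last factor of [odd_fact (k + q).+1], where [q] is the sum over the
    vertices already present. *)
Lemma prod_hook_le t : uniq t -> down_closed D t -> linear_ext D t ->
  \prod_(v <- t) hook D v <= odd_fact (\sum_(v <- t) half_indeg v).
Proof.
elim: t => [|x t IH] ut ct lt; first by rewrite !big_nil /odd_fact big_ord0.
have [ut' ct' lt'] := linear_ext_behead ut ct lt; have {}IH := IH ut' ct' lt'.
have hx := hook_le_sum ut ct (mem_head x t); rewrite !big_cons in hx *.
case E: (half_indeg x) => [|k]; first by rewrite hook_source // mul1n.
rewrite E in hx; rewrite addSn odd_factS mulnC; apply: leq_mul.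
  by apply: leq_trans IH (odd_fact_le _); apply: leq_addl.
by apply: leq_trans hx _; lia.
Qed.

Lemma prod_hook_eq (x0 : V) t : uniq t -> down_closed D t -> linear_ext D t ->
  \prod_(v <- t) hook D v = odd_fact (\sum_(v <- t) half_indeg v) ->
  exists w : nat -> V,
    (forall i, i < \sum_(v <- t) half_indeg v ->
       half_indeg (w i) = 1 /\ hook D (w i) = 2 * i + 3) /\
    (forall v, v \in t -> 0 < half_indeg v ->
       exists2 i, i < \sum_(v <- t) half_indeg v & v = w i).
Proof.
elim: t => [|x t IH] ut ct lt.
  by exists (fun=> x0); split=> [i|v]; rewrite ?big_nil ?ltn0.
have [ut' ct' lt'] := linear_ext_behead ut ct lt; have {}IH := IH ut' ct' lt'.
have hx := hook_le_sum ut ct (mem_head x t).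
have hP := prod_hook_le ut' ct' lt'; rewrite !big_cons in hx *.
set q := \sum_(v <- t) half_indeg v in hx hP IH *.
set P := \prod_(v <- t) hook D v in hP IH *.
case E: (half_indeg x) => [|k].
  rewrite hook_source // mul1n add0n => /IH [w [w1 w2]]; exists w; split=> // v.
  by rewrite inE => /orP [/eqP ->|/w2 //]; rewrite E.
rewrite E in hx; rewrite addSn odd_factS => prodE.
have P0 : 0 < P by apply: prodn_gt0 => v; apply: hook_gt0.
(* The hook of [x] is at most [2 * (k + q) + 3], so equality leaves at least the other factors to
   [P]. Together with [hP] this forces [k = 0]. *)
have Pge : odd_fact (k + q) <= P.
  rewrite -(leq_pmul2r (m := 2 * (k + q) + 3)) ?addn3 // -addn3 -prodE mulnC leq_mul2l.
  by apply/orP; right; apply: leq_trans hx _; lia.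
have k0 : k = 0.
  case: k {E prodE hx} Pge => // k /leq_trans /(_ hP); rewrite leqNgt odd_fact_lt //; lia.
subst k; rewrite add0n in prodE Pge hx *.
have PE : P = odd_fact q by apply/eqP; rewrite eqn_leq hP Pge.
have hxE : hook D x = 2 * q + 3.
  by apply/eqP; rewrite -(eqn_pmul2r P0) prodE PE mulnC.
have [w [w1 w2]] := IH PE.
(* The sequence [w] lists the non-sources by increasing hook, and [x] comes last. *)
exists (fun i => if i == q then x else w i); split=> [i|v].
  rewrite ltnS leq_eqVlt; case: eqVneq => [->|_] //= iq; exact: w1.
rewrite inE; case: eqVneq => [-> _ _|_ /= vt v0]; first by exists q; rewrite ?eqxx.
have [i iq ->] := w2 v vt v0; exists i; first exact: ltnW.
by rewrite (ltn_eqF iq).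
Qed.
End HookProduct.

(** * Recognising the hairbrush *)

(** The even orientation of the hairbrush: [v_(j+1)] receives arcs from [v_j] and [u_(j+1)], while
    [v_0] and the hairs are sources. *)
Definition hairbrush_arc n (x y : 'I_n.+1 + 'I_n) :=
  match x, y with
  | inl i, inl j => val j == i.+1
  | inr i, inl j => val j == i.+1
  | _, inr _ => false
  end.

Lemma hairbrush_arcE n (x y : 'I_n.+1 + 'I_n) :
  hairbrush_rel x y = hairbrush_arc x y || hairbrush_arc y x.
Proof. by case: x y => [i|i] [j|j] //=; rewrite orbF. Qed.

Section Chain.
Variables (V : finType) (D : rel V).
Hypothesis acD : forall x y, D x y -> ~~ connect D y x.
Hypothesis evD : forall v, ~~ odd #|[set u | D u v]|.
Variables (n : nat) (w : nat -> V).
Hypothesis w_half : forall i, i < n -> half_indeg D (w i) = 1.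
Hypothesis w_hook : forall i, i < n -> hook D (w i) = 2 * i + 3.
Hypothesis w_all : forall v, 0 < half_indeg D v -> exists2 i, i < n & v = w i.

(** Only [w 0], ..., [w j] can be non-sources below [w j], by size of hooks. If [w i] were missing,
    [hook_indeg] would bound the hook of [w j] by [2 * j + 1]. *)
Lemma chain_connect i j : i <= j -> j < n -> connect D (w i) (w j).
Proof.
move=> ij jn; apply/negPn/negP => nij.
have i'j : i < j by rewrite ltn_neqAle ij andbT; apply: contraNneq nij => ->; apply: connect0.
have := hook_indeg evD (w j); rewrite w_hook //.
suff : \sum_(b | connect D b (w j)) half_indeg D b <= j by lia.
pose B := [set w k | k : 'I_j.+1 in [set~ inord i : 'I_j.+1]].
apply: (@leq_trans (\sum_(b in B) 1)); last first.
  rewrite sum1_card; apply: leq_trans (leq_imset_card _ _) _.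
  by rewrite cardsC1 card_ord.
rewrite big_mkcond [X in _ <= X]big_mkcond; apply: leq_sum => b _; case: ifP => // bj.
case: (posnP (half_indeg D b)) => [-> //|/w_all [k kn bk]]; subst b.
rewrite w_half //; case: ifP => // /negP []; apply/imsetP.
have kj : k < j.+1 by have := hook_le bj; rewrite !w_hook //; lia.
exists (Ordinal kj) => //; rewrite !inE; apply: contraNneq nij => /(congr1 val) /=.
by rewrite inordK // => <-.
Qed.

(** The first vertex after [w i] on a path to [w i.+1] is a non-source, and no hook size lies
    strictly between. *)
Lemma chain_arc i : i.+1 < n -> D (w i) (w i.+1).
Proof.
move=> i1n; have i_n := ltnW i1n.
have cn : connect D (w i) (w i.+1) by apply: chain_connect.
have ne : w i != w i.+1.
  by apply/eqP => E; have := w_hook i_n; rewrite E w_hook //; lia.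
have [y Dy yw] := connect_step cn ne.
have [k kn yk] := w_all (half_indeg_gt0 evD Dy); subst y.
have := hook_lt acD Dy; have := hook_le yw; rewrite !w_hook // => h1 h2.
by have -> : i.+1 = k by lia.
Qed.

(** The index is shifted: [w i] becomes [v_(i+1)]. For positive [n], [v_0] is one of the two
    in-neighbours of [w 0]. *)
Definition spine x0 i :=
  if i is i'.+1 then w i' else odflt x0 [pick x | D x (w 0)].
(** This is [u_(i+1)], the in-neighbour of [w i] off the spine. *)
Definition hair x0 i :=
  odflt x0 [pick x | D x (w i) && (x != spine x0 i)].

Variable x0 : V.
Local Notation v := (spine x0).
Local Notation u := (hair x0).

Lemma spine_arc i : i < n -> D (v i) (v i.+1).
Proof.
case: i => [|i] i_n; last exact: chain_arc.
rewrite /=; case: pickP => //= H; have := indegE evD (w 0).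
rewrite w_half // (_ : [set x | D x (w 0)] = set0) ?cards0 //.
by apply/setP => x; rewrite !inE H.
Qed.

Lemma spine_in i : i < n -> [set x | D x (w i)] = [set v i; u i] /\ u i != v i.
Proof.
move=> i_n; have cA := indegE evD (w i); rewrite w_half // in cA.
have vA : v i \in [set x | D x (w i)] by rewrite inE; apply: spine_arc.
rewrite (cardsD1 (v i)) vA in cA.
have /cards1P [z zE] : #|[set x | D x (w i)] :\ v i| == 1 by lia.
have : z \in [set x | D x (w i)] :\ v i by rewrite zE set11.
rewrite !inE => /andP [zv Dz].
have uz : u i = z.
  rewrite /hair; case: pickP => [y /andP [Dy yv]|/(_ z)] /=; last by rewrite zv Dz.
  by apply/set1P; rewrite -zE !inE yv.
by rewrite uz zv -(setD1K vA) zE.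
Qed.

Lemma spine_connect i j : i <= j -> j <= n -> connect D (v i) (v j).
Proof.
move=> /subnK <-; elim: (j - i) => [|k IH] kn; first exact: connect0.
by apply: connect_trans (IH _) (connect1 _); [apply: ltnW | apply: spine_arc].
Qed.

(** A non-source has hook at least 3, but [v 0] has a smaller hook than [w 0], whose hook is 3. *)
Lemma spine0_source : half_indeg D (v 0) = 0.
Proof.
case: (posnP (half_indeg D (v 0))) => // /[dup] /w_all [k kn vk] _.
have n0 : 0 < n by lia.
by have := hook_lt acD (spine_arc n0); rewrite vk /= !w_hook //; lia.
Qed.

(* Otherwise everything below w i is either w i or below v i, and the hook
   of w i is too small. *)
Lemma hair_not_below i : i < n -> ~~ connect D (u i) (v i).
Proof.
move=> i_n; have [inE_ uv] := spine_in i_n; apply/negP => cuv.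
case: i i_n inE_ uv cuv => [|i] i_n inw uv cuv.
  by rewrite (connect_source evD spine0_source cuv) eqxx in uv.
suff : hook D (w i.+1) <= (hook D (w i)).+1 by rewrite !w_hook //; lia.
rewrite /hook -[X in _ <= X]add1n -(cards1 (w i.+1)); apply: leq_trans (leq_card_setU _ _).1.
apply: subset_leq_card; apply/subsetP => y; rewrite !inE => yw.
case: eqVneq => //= yw'; have [z yz] := connect_last_step yw yw'.
move=> Dz; have : z \in [set x | D x (w i.+1)] by rewrite inE.
rewrite inw !inE => /orP [] /eqP zE; rewrite zE in yz => //.
exact: connect_trans yz cuv.
Qed.

Lemma hair_arc i : i < n -> D (u i) (v i.+1).
Proof.
move=> i_n; have [/setP /(_ (u i))] := spine_in i_n.
by rewrite !inE eqxx orbT.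
Qed.

(** If [u i] were some [w k], comparing hooks would give [k < i] and place it on the spine below
    [v i]. *)
Lemma hair_source i : i < n -> half_indeg D (u i) = 0.
Proof.
move=> i_n; case: (posnP (half_indeg D (u i))) => // /w_all [k kn uk].
have := hook_lt acD (hair_arc i_n); rewrite uk /= !w_hook // => ki.
have := hair_not_below i_n; rewrite uk -/(v k.+1) spine_connect //; lia.
Qed.

Definition hairbrush_map (x : 'I_n.+1 + 'I_n) : V :=
  match x with inl i => v i | inr i => u i end.

(** Hooks separate the spine. A hair differs from [v 0] because it is not below [v i], and from the
    other [v j] because it is a source. Of two hairs, only the earlier one is below the spine vertex
    [v j] of the later. *)
Lemma hairbrush_map_inj : injective hairbrush_map.
Proof.
have vlt i j : i < j -> j <= n -> v i != v j.
  move=> ij jn; apply/eqP => E; have := hook_lt acD (spine_arc (leq_trans ij jn)).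
  by rewrite ltnNge E (hook_le (spine_connect ij jn)).
have uv i j : i < n -> j <= n -> u i != v j.
  move=> i_n; case: j => [_|j jn]; apply/eqP => E.
    by have := hair_not_below i_n; rewrite E spine_connect // ltnW.
  by have := hair_source i_n; rewrite E /= w_half.
have ult i j : i < j -> j < n -> u i != u j.
  move=> ij jn; apply/eqP => E; have := hair_not_below jn; rewrite -E.
  have i_n := ltn_trans ij jn.
  by rewrite (connect_trans (connect1 (hair_arc i_n)) (spine_connect ij (ltnW jn))).
case=> [i|i] [j|j] /= E; have ii := ltn_ord i; have jj := ltn_ord j.
- congr inl; apply: val_inj => /=; case: (ltngtP i j) => // ij.
    by have := vlt _ _ ij jj; rewrite E eqxx.
  by have := vlt _ _ ij ii; rewrite E eqxx.
- by have := uv _ _ jj ii; rewrite E eqxx.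
- by have := uv _ _ ii jj; rewrite E eqxx.
congr inr; apply: val_inj => /=; case: (ltngtP i j) => // ij.
  by have := ult _ _ ij jj; rewrite E eqxx.
by have := ult _ _ ij ii; rewrite E eqxx.
Qed.

Lemma hairbrush_map_arc x y :
  D (hairbrush_map x) (hairbrush_map y) = hairbrush_arc x y.
Proof.
have src z a : half_indeg D a = 0 -> D z a = false.
  by move=> a0; apply/negP => /(half_indeg_gt0 evD); rewrite a0.
case: y => [[[|j] jn]|j]; last by rewrite src ?hair_source //; case: x.
  by rewrite src ?spine0_source //; case: x.
have jn' : j < n by []; have [/setP /(_ (hairbrush_map x)) E _] := spine_in jn'.
rewrite !inE in E; rewrite E.
rewrite -[v j]/(hairbrush_map (inl (Ordinal (ltnW jn)))).
rewrite -[u j]/(hairbrush_map (inr (Ordinal jn'))).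
rewrite !(inj_eq hairbrush_map_inj); case: x {E} => [i|i] /=.
  by rewrite orbF eqSS; apply/eqP/eqP => [[->]|/= E] //; congr inl; apply: val_inj.
by rewrite eqSS; apply/eqP/eqP => [[->]|/= E] //; congr inr; apply: val_inj.
Qed.

Lemma hairbrush_map_bij : #|V| = (2 * n).+1 -> bijective hairbrush_map.
Proof.
move=> cardV; apply: inj_card_bij hairbrush_map_inj _.
by rewrite card_sum !card_ord cardV; lia.
Qed.

End Chain.

(** * Rotations of linear extensions *)

Section Rotations.
Variables (G : sgraph) (D : rel G).
Hypothesis oD : orientation D.
Hypothesis conG : forall x y : G, connect (@edge G) x y.
Implicit Types (s t : seq G).

Lemma crossing_edge (A : {pred G}) x y : x \in A -> y \notin A ->
  exists a b, [/\ edge a b, a \in A & b \notin A].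
Proof.
move=> xA yA; have /connectP [p] := conG x y.
elim: p x xA => [|z p IH] x xA /=; first by move=> _ yx; rewrite yx xA in yA.
case/andP=> exz pth lst; case: (boolP (z \in A)) => zA; last by exists x, z.
exact: IH pth lst.
Qed.

(** Rotation swaps two blocks joined by some edge; [t] forbids one direction of that edge and its
    rotation the other. *)
Lemma linear_ext_rot k t : perm_eq t (enum G) -> linear_ext D t ->
  0 < k < size t -> ~~ linear_ext D (rot k t).
Proof.
move=> pt lt /andP [k0 kt]; apply/negP => lrt.
have ut : uniq t by rewrite (perm_uniq pt) enum_uniq.
move: lt lrt; rewrite /linear_ext /rot -{1}(cat_take_drop k t) !pairwise_cat.
case/andP=> /allrelP td _ /andP [/allrelP dt _].
move: ut; rewrite -{1}(cat_take_drop k t) cat_uniq => /and3P [_ /hasPn dis _].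
have [x xA] : exists x, x \in take k t.
  by case: (t) k0 kt => // x t'; case: (k) => // k' _ _; exists x; rewrite /= mem_head.
have [y yA] : exists y, y \in drop k t.
  by exists (nth x (drop k t) 0); apply: mem_nth; rewrite size_drop subn_gt0.
have [a [b [eab aA bA]]] := crossing_edge xA (dis y yA).
have bd : b \in drop k t.
  have : b \in t by rewrite (perm_mem pt) mem_enum.
  by rewrite -{1}(cat_take_drop k t) mem_cat (negbTE bA).
by move: eab; rewrite -oD.1 (negbTE (td _ _ aA bd)) (negbTE (dt _ _ bd aA)).
Qed.

Definition rotations := [seq rot i t | i <- iota 0 #|G|,
  t <- [seq t <- permutations (enum G) | linear_ext D t]].

Lemma size_rotations :
  size rotations = #|G| * count (linear_ext D) (permutations (enum G)).
Proof. by rewrite size_allpairs size_iota size_filter. Qed.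

(** If [rot i s = rot j t] with [i <= j], then [s] is the rotation of [t] by [j - i], which must
    therefore be 0. *)
Lemma rotations_uniq : uniq rotations.
Proof.
suff aux i j s t : i <= j -> j < #|G| -> perm_eq s (enum G) -> perm_eq t (enum G) ->
    linear_ext D s -> linear_ext D t -> rot i s = rot j t -> (i, s) = (j, t).
  apply: allpairs_uniq; rewrite ?iota_uniq ?filter_uniq ?permutations_uniq //.
  move=> [i s] [j t] /allpairsP [[i' s'] /= [ii ss [-> ->]]].
  move=> /allpairsP [[j' t'] /= [jj tt [-> ->]]] {i s j t} /=.
  move: ii ss jj tt; rewrite !mem_iota !mem_filter !mem_permutations /= add0n.
  move=> ii /andP [ls ps] jj /andP [lt pt].
  case: (leqP i' j') => ij E; first exact: aux.
  by apply/esym; apply: aux => //; apply: ltnW.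
move=> ij jG ps pt ls lt E.
have sG : size s = #|G| by rewrite (perm_size ps) -cardE.
have tG : size t = #|G| by rewrite (perm_size pt) -cardE.
have sE : s = rot (j - i) t.
  apply: (@rot_inj i); rewrite E -rotD ?subnKC // tG; exact: ltnW.
have j_i : j - i = 0.
  case: (posnP (j - i)) => // ji0.
  have : 0 < j - i < size t by rewrite ji0 tG (leq_ltn_trans (leq_subr _ _) jG).
  by move=> /(linear_ext_rot pt lt); rewrite -sE ls.
by rewrite sE j_i rot0; have -> : i = j by lia.
Qed.

Lemma rotations_sub : {subset rotations <= permutations (enum G)}.
Proof.
move=> s /allpairsP [[i t] /= [_ + ->]]; rewrite mem_filter !mem_permutations.
by rewrite perm_rot => /andP [].
Qed.

Lemma count_linear_ext_le :
  #|G| * count (linear_ext D) (permutations (enum G)) <= #|G|`!.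
Proof.
rewrite -size_rotations [in X in _ <= X]cardE -size_permutations ?enum_uniq //.
exact: uniq_leq_size rotations_uniq rotations_sub.
Qed.

(* No rotation of a list starting with b, c, d, a is a linear extension. *)
Lemma count_linear_ext_lt a b c d : D a b -> D c d -> uniq [:: b; c; d; a] ->
  #|G| * count (linear_ext D) (permutations (enum G)) < #|G|`!.
Proof.
move=> Dab Dcd un; pose r := [seq x <- enum G | x \notin [:: b; c; d; a]].
pose t := [:: b; c; d; a] ++ r.
have pt : perm_eq t (enum G).
  apply: uniq_perm; rewrite ?enum_uniq //.
    rewrite cat_uniq un filter_uniq ?enum_uniq // andbT; apply/hasPn => x.
    by rewrite mem_filter => /andP [].
  by move=> x; rewrite mem_cat mem_filter mem_enum andbT orbN.
rewrite -size_rotations [in X in _ < X]cardE -size_permutations ?enum_uniq //.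
apply: (@uniq_leq_size _ (t :: rotations)).
  rewrite /= rotations_uniq andbT; apply/negP => /allpairsP [[i s] /= [_ + ts]].
  rewrite mem_filter mem_permutations => /andP [ls ps].
  have sE : s = rotr i t by rewrite ts rotK.
  move: ls; rewrite sE /rotr /rot /linear_ext; move: (size t - i) => k {sE ts ps}.
  (* Every rotation keeps [c] before [d], except the one that cuts between them, which puts [a]
     before [b]. *)
  case: k => [|[|[|[|k]]]]; rewrite /t /= ?drop0 ?take0 ?cats0 ?Dcd ?andbF //=.
  - by rewrite !all_cat /= Dab ?andbF.
  - by rewrite pairwise_cat /= Dcd ?andbF.
  by rewrite pairwise_cat /= Dcd ?andbF.
move=> x; rewrite inE => /orP [/eqP ->|/rotations_sub //].
by rewrite mem_permutations.
Qed.

End Rotations.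

(** * Trees with an odd number of vertices *)

Section Tree.
Variables (n : nat) (T : sgraph).
Hypothesis hT : is_tree T.
Hypothesis cardT : #|T| = (2 * n).+1.

Let acT : acyclic T := hT.2.
Let conT : forall x y : T, connect (@edge T) x y := hT.1.2.

Section Orientation.
Variable D : rel T.
Hypothesis evD : even_orientation D.

Let acD x y : D x y -> ~~ connect D y x := orientation_acyclic acT evD.1.

Lemma eta_linear_ext : eta T = count (linear_ext D) (permutations (enum T)).
Proof.
rewrite eta_count; apply: eq_in_count => t; rewrite mem_permutations.
by move=> pt; rewrite (rev_even_linear_ext evD.1 acT evD.2 pt).
Qed.

Lemma down_closed_enum : down_closed D (enum T).
Proof. by move=> x y _ _; rewrite mem_enum. Qed.

Lemma eta_hook_bound : (2 * n).+1`! <= eta T * \prod_(v : T) hook D v.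
Proof.
have := hook_bound acD (enum_uniq T) down_closed_enum.
by rewrite -cardE cardT -eta_linear_ext big_enum.
Qed.

(** The hook bound also yields the existence of a linear extension, since its left side is
    positive. *)
Lemma eta_gt0 : 0 < eta T.
Proof.
have := leq_trans (fact_gt0 _) eta_hook_bound.
by rewrite muln_gt0 => /andP [].
Qed.

Lemma linear_ext_exists : exists2 t, perm_eq t (enum T) & linear_ext D t.
Proof.
have := eta_gt0; rewrite eta_linear_ext -has_count => /hasP [t].
by rewrite mem_permutations; exists t.
Qed.

Lemma sum_half_indeg : \sum_(v : T) half_indeg D v = n.
Proof.
have [r _] : exists r : T, r \in T by apply/card_gt0P; rewrite cardT.
have := sum_indeg D; rewrite (card_arcs evD.1).
have := card_edges_tree acT conT r; rewrite cardT => -[<-].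
under eq_bigr do rewrite (indegE evD.2); rewrite -big_distrr /=; lia.
Qed.

Lemma prod_hook_tree_le : \prod_(v : T) hook D v <= odd_fact n.
Proof.
have [t pt lt] := linear_ext_exists.
have := prod_hook_le acD evD.2 (t := t).
rewrite (perm_big _ pt) big_enum [\sum_(v <- t) _](perm_big _ pt) big_enum /=.
rewrite sum_half_indeg; apply=> //; first by rewrite (perm_uniq pt) enum_uniq.
by move=> x y _ _; rewrite (perm_mem pt) mem_enum.
Qed.

Lemma prod_hook_tree_eq : \prod_(v : T) hook D v = odd_fact n ->
  isomorphic T (hairbrush n).
Proof.
move=> E; have [t pt lt] := linear_ext_exists.
have [x0 _] : exists r : T, r \in T by apply/card_gt0P; rewrite cardT.
have := prod_hook_eq acD evD.2 x0 (t := t).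
rewrite (perm_big _ pt) big_enum [\sum_(v <- t) _](perm_big _ pt) big_enum /=.
rewrite sum_half_indeg => -[|||//|w [w1 w2]] //.
- by rewrite (perm_uniq pt) enum_uniq.
- by move=> x y _ _; rewrite (perm_mem pt) mem_enum.
have w3 v : 0 < half_indeg D v -> exists2 i, i < n & v = w i.
  by apply: w2; rewrite (perm_mem pt) mem_enum.
have whalf i (i_n : i < n) := (w1 i i_n).1.
have whook i (i_n : i < n) := (w1 i i_n).2.
have [f fK gK] := hairbrush_map_bij acD evD.2 whalf whook w3 x0 cardT.
exists f; first by exists (hairbrush_map D w x0).
move=> x y; rewrite -[in RHS](gK x) -[in RHS](gK y) -evD.1.1.
rewrite !(hairbrush_map_arc acD evD.2 whalf whook w3).
exact: hairbrush_arcE.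
Qed.

(** Let [a] and [b] be two in-neighbours of a non-source [c]. If all arcs meet [c], the tree is a
    star. Otherwise some arc avoids [c], and it misses [a] or [b], for else [a], [b], [c] would be a
    triangle. *)
Lemma disjoint_arcs_or_star :
  (exists a b c d, [/\ D a b, D c d & uniq [:: b; c; d; a]]) \/
  exists c : T, forall x y, edge x y = ((x == c) != (y == c)).
Proof.
have irr x : edge x x = false := edge_irr x.
case: (posnP n) => [n0|n_gt0].
  right; have /card_le1P : #|T| <= 1 by rewrite cardT n0.
  have [c _] : exists r : T, r \in T by apply/card_gt0P; rewrite cardT.
  move=> all1; exists c => x y; have E z : z = c.
    by have := all1 c isT z; rewrite !inE => /esym/eqP.
  by rewrite (E x) (E y) irr eqxx.
have [c c0] : exists c, 0 < half_indeg D c.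
  apply/existsP; apply: contraTT n_gt0 => /existsPn H; rewrite -sum_half_indeg.
  by rewrite big1 // => v _; have := H v; case: half_indeg.
have /card_gt1P [a [b []]] : 1 < #|[set u | D u c]| by rewrite (indegE evD.2); lia.
rewrite !inE => Dac Dbc ab.
case: (boolP [exists x, exists y, [&& D x y, x != c & y != c]]); last first.
  move=> /existsPn H; right; exists c.
  have ec x y : edge x y -> (x == c) || (y == c).
    have D_ec x' y' : D x' y' -> (x' == c) || (y' == c).
      move=> Dxy; have /existsPn /(_ y') := H x'; rewrite Dxy /= -negb_or.
      by rewrite negbK.
    by rewrite -evD.1.1 => /orP [] /D_ec //; rewrite orbC.
  (* By connectedness [x] has an incident edge, and that edge meets [c]. *)
  have xc x : x != c -> edge x c.
    move=> xc; have [z exz _] := connect_step (conT x c) xc.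
    by have := ec _ _ exz; rewrite (negbTE xc) => /eqP <-.
  move=> x y; case: (eqVneq x c) (eqVneq y c) => [->|xc'] [->|yc'] //=.
  - by rewrite edge_sym xc.
  - exact: xc.
  by apply/negP => /ec; rewrite (negbTE xc') (negbTE yc').
case/existsP=> x /existsP [y /and3P [Dxy xc yc]]; left.
have eac := orientation_sub evD.1 Dac; have ebc := orientation_sub evD.1 Dbc.
have exy := orientation_sub evD.1 Dxy.
have ac : a != c by apply/eqP => E; rewrite E irr in eac.
have bc : b != c by apply/eqP => E; rewrite E irr in ebc.
have xy : x != y by apply/eqP => E; rewrite E irr in exy.
have un z : z != x -> z != y -> z != c -> uniq [:: c; x; y; z].
  by move=> *; rewrite /= !inE !negb_or !(eq_sym c) !(eq_sym _ z); do !(apply/andP; split).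
suff : (a \notin [:: x; y]) || (b \notin [:: x; y]).
  case/orP; rewrite !inE negb_or => /andP [zx zy]; [exists a | exists b];
    by exists c, x, y; split=> //; apply: un.
rewrite -negb_and; apply/negP => /andP []; rewrite !inE => ax bx.
have eab : edge a b.
  move: ab; case/orP: ax => /eqP ->; case/orP: bx => /eqP ->; rewrite ?eqxx //.
  by rewrite edge_sym.
apply: (@acT [:: a; b; c] isT).
by rewrite /ucycle /= eab ebc (edge_sym c) eac /= !inE negb_or ab ac bc.
Qed.

End Orientation.

(** * The two bounds and the extremal trees *)

Lemma even_orientation_tree : exists D : rel T, even_orientation D.
Proof.
by apply: even_orientation_exists => //; rewrite cardT /= mul2n odd_double.
Qed.

Lemma eta_ge : n`! * 2 ^ n <= eta T.
Proof.
have [D evD] := even_orientation_tree.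
rewrite -(leq_pmul2l (odd_fact_gt0 n)) odd_fact_double [X in _ <= X]mulnC.
apply: leq_trans (eta_hook_bound evD) _.
by rewrite leq_mul2l prod_hook_tree_le ?orbT.
Qed.

Lemma eta_le : eta T <= (2 * n)`!.
Proof.
have [D evD] := even_orientation_tree.
have := count_linear_ext_le evD.1 conT; rewrite -eta_linear_ext // cardT factS.
by rewrite leq_pmul2l.
Qed.

(** At the minimum the hook bound forces the product of the hooks up to its maximum [odd_fact n]. *)
Lemma eta_min_hairbrush : eta T = n`! * 2 ^ n -> isomorphic T (hairbrush n).
Proof.
move=> E; have [D evD] := even_orientation_tree; apply: (prod_hook_tree_eq evD).
apply/eqP; rewrite eqn_leq prod_hook_tree_le //=.
have : 0 < n`! * 2 ^ n by rewrite muln_gt0 fact_gt0 expn_gt0.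
move=> /leq_pmul2r <-; rewrite odd_fact_double -E [X in _ <= X]mulnC; exact: eta_hook_bound.
Qed.

Lemma star_of_center (c : T) :
  (forall x y, edge x y = ((x == c) != (y == c))) -> isomorphic T (star (2 * n)).
Proof.
move=> ec; pose s := enum (predC1 c).
have sz : size s = 2 * n by rewrite -cardE cardC1 cardT.
(* The centre is not in [s], so its index is [2 * n], out of range, and [insub] returns [None]. *)
pose f (x : T) : option 'I_(2 * n) := insub (index x s).
have fS x : isSome (f x) = (x != c).
  by rewrite isSome_insub /= -[X in _ < X]sz index_mem mem_enum !inE.
exists f; last by move=> x y; rewrite ec /= /star_rel !fS; case: (x == c); case: (y == c).
apply: inj_card_bij; last by rewrite card_option card_ord cardT.
move=> x y E; have := fS x; rewrite E fS.
case: (eqVneq y c) (eqVneq x c) => [->|yc] [->|xc] // _.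
have xs : x \in s by rewrite mem_enum.
have ys : y \in s by rewrite mem_enum.
apply: (index_inj c xs ys).
move: E; rewrite /f.
have xi : index x s < 2 * n by rewrite -sz index_mem.
have yi : index y s < 2 * n by rewrite -sz index_mem.
by rewrite !insubT => -[].
Qed.

Lemma eta_max_star : eta T = (2 * n)`! -> isomorphic T (star (2 * n)).
Proof.
move=> E; have [D evD] := even_orientation_tree.
case: (disjoint_arcs_or_star evD) => [[a [b [c [d [Dab Dcd un]]]]]|[c ec]].
  have := count_linear_ext_lt evD.1 conT Dab Dcd un.
  by rewrite -eta_linear_ext // E cardT -factS ltnn.
exact: star_of_center ec.
Qed.

(** Orient all edges towards the centre. Leaves have hook 1 and the centre at most [2n+1], so the
    hook bound gives the missing inequality. *)
Lemma eta_star : isomorphic T (star (2 * n)) -> eta T = (2 * n)`!.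
Proof.
move=> [f [g fK gK] fe]; apply/eqP; rewrite eqn_leq eta_le /=.
pose c := g None; pose D (x y : T) := (x != c) && (y == c).
have fS x : isSome (f x) = (x != c).
  by rewrite -(inj_eq (can_inj fK)) gK; case: (f x).
have ec (x y : T) : edge x y = ((x == c) != (y == c)).
  by rewrite -fe /= /star_rel !fS; case: (x == c); case: (y == c).
have src v : v != c -> #|[set u | D u v]| = 0.
  by move=> vc; apply/eqP; rewrite cards_eq0; apply/eqP/setP => u; rewrite !inE /D (negbTE vc) andbF.
have evD : even_orientation D.
  split; first by split=> x y; rewrite /D ?ec; case: (x == c); case: (y == c).
  move=> v; case: (eqVneq v c) => [->|/src -> //].
  rewrite (_ : [set u | _] = [set~ c]) ?cardsC1 ?cardT ?mul2n ?odd_double //.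
  by apply/setP => u; rewrite !inE /D eqxx andbT.
have := eta_hook_bound evD; rewrite (bigD1 c) //= big1 ?muln1 => [|v vc].
  rewrite factS [X in X <= _]mulnC => H; rewrite -(leq_pmul2r (ltn0Sn (2 * n))).
  apply: leq_trans H _; rewrite leq_mul2l -cardT; apply/orP; right; exact: max_card.
by apply: (hook_source evD.2); rewrite /half_indeg src.
Qed.

(** In the even orientation all out-degrees are at most 1, so the hook formula is exact; it remains
    to bound the product of the hooks below by [odd_fact n]. *)
Lemma eta_hairbrush : isomorphic T (hairbrush n) -> eta T = n`! * 2 ^ n.
Proof.
move=> [f [g fK gK] fe]; apply/eqP; rewrite eqn_leq eta_ge andbT.
pose D (x y : T) := hairbrush_arc (f x) (f y).
have DE a b : D (g a) (g b) = hairbrush_arc a b by rewrite /D !gK.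
have evD : even_orientation D.
  split; first split=> x y.
  - by rewrite -fe /= hairbrush_arcE.
  - by rewrite /D; case: (f x) (f y) => [i|i] [j|j] //=; rewrite ?andbF //; lia.
  move=> v; rewrite /D; case: (f v) => [[[|j] jn]|j].
  - by rewrite (_ : [set u | _] = set0) ?cards0 //; apply/setP => u; rewrite !inE; case: (f u).
  - have jn' : j < n by [].
    rewrite (_ : [set u | _] = [set g (inl (Ordinal (ltnW jn))); g (inr (Ordinal jn'))]).
      by rewrite cards2 (inj_eq (can_inj gK)).
    apply/setP => u; rewrite !inE -!(inj_eq (can_inj fK)) !gK.
    by case: (f u) => i /=; rewrite ?orbF /= eqSS eq_sym.
  - by rewrite (_ : [set u | _] = set0) ?cards0 //; apply/setP => u; rewrite !inE; case: (f u).
have acD x y : D x y -> ~~ connect D y x := orientation_acyclic acT evD.1.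
have out1 x y z : D x y -> D x z -> y = z.
  move=> Dxy Dxz; apply: (can_inj fK); move: Dxy Dxz; rewrite /D.
  case: (f x) (f y) (f z) => i [j|j] [k|k] //= /eqP E /eqP E'; congr inl; apply: val_inj.
    by rewrite /= E E'.
  by rewrite /= E E'.
have := hook_formula acD out1 (enum_uniq T) (@down_closed_enum D).
rewrite -cardE cardT -eta_linear_ext // big_enum /= => HF.
rewrite -(leq_pmul2l (odd_fact_gt0 n)) odd_fact_double -HF [X in X <= _]mulnC leq_mul2l.
apply/orP; right.
(* The vertices [v_(i+1)] and [u_(i+1)] are below [v_(i+1)] but not below [v_i]. *)
have step (i : 'I_n) : (hook D (g (inl (widen_ord (leqnSn n) i)))).+2 <= hook D (g (inl (lift ord0 i))).
  set a := g _; set b := g (inl (lift _ _)); pose c := g (inr i).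
  have Dab : D a b by rewrite DE /= /bump.
  have Dcb : D c b by rewrite DE /= /bump.
  have nba : ~~ connect D b a := acD _ _ Dab.
  have nca : ~~ connect D c a.
    apply/negP => ca; have [|z Dcz za] := connect_step ca.
      by rewrite (inj_eq (can_inj gK)).
    by rewrite -(out1 _ _ _ Dcb Dcz) (negbTE nba) in za.
  rewrite /hook (_ : _.+2 = #|b |: (c |: [set u | connect D u a])|); last first.
    by rewrite !cardsU1 !inE negb_or nba nca (inj_eq (can_inj gK)).
  apply: subset_leq_card; apply/subsetP => z; rewrite !inE.
  case/or3P=> [/eqP ->|/eqP ->|za]; first exact: connect0.
    exact: connect1.
  exact: connect_trans za (connect1 Dab).
have hv k (kn : k < n.+1) : 2 * k + 1 <= hook D (g (inl (Ordinal kn))).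
  elim: k kn => [|k IH] kn; first exact: hook_gt0.
  have kn' : k < n by [].
  have := step (Ordinal kn'); have := IH (ltnW kn).
  have -> : widen_ord (leqnSn n) (Ordinal kn') = Ordinal (ltnW kn) by apply: val_inj.
  have -> : lift ord0 (Ordinal kn') = Ordinal kn by apply: val_inj.
  lia.
rewrite (reindex g) /=; last by exists f => ? _; rewrite ?fK ?gK.
(* Only [v_1], ..., [v_n] supply the factors of [odd_fact n]; [v_0] and the hairs are bounded below
   by 1. *)
rewrite big_sumType /= big_ord_recl /odd_fact.
rewrite -[X in X <= _]mul1n -[X in X <= _]muln1; apply: leq_mul.
  apply: leq_mul; first exact: hook_gt0.
  apply: leq_prod => i _; have := hv i.+1 (ltn_ord i).
  have -> : Ordinal (ltn_ord i : i.+1 < n.+1) = lift ord0 i by apply: val_inj.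
  by apply: leq_trans; lia.
by apply: prodn_gt0 => i; apply: hook_gt0.
Qed.

End Tree.

Theorem theorem1p6 (n : nat) (T : sgraph) (hT : is_tree T)
    (hcard : #|T| = (2 * n).+1) :
  [/\ n`! * 2 ^ n <= nu T, nu T = eta T & eta T <= (2 * n)`!] /\
  (nu T = n`! * 2 ^ n <-> isomorphic T (hairbrush n)) /\
  (nu T = (2 * n)`! <-> isomorphic T (star (2 * n))).
Proof.
rewrite (nu_eta hT); split; first by split; rewrite ?eta_ge ?eta_le.
split; split.
- exact: eta_min_hairbrush.
- exact: eta_hairbrush.
- exact: eta_max_star.
- exact: eta_star.
Qed.
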